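(* Let $n\in\mathbb N$ and $B,C\in\mathbb C^{n\times n}$. Let $X,Z\in\mathbb C^{n\times n}$ be right solvents of the pencil $L(\lambda)=\lambda^2\mathbf 1+\lambda B+C$ that form a complete pair. Let $$U(t)=\frac1{2\pi i}\int_\Gamma e^{\lambda t}(\lambda^2\mathbf1+\lambda B+C)^{-1}\,d\lambda,\qquad t\in\mathbb R,$$ whose derivative with respect to $t$ is $$U'(t)=\frac1{2\pi i}\int_\Gamma \lambda e^{\lambda t}(\lambda^2\mathbf1+\lambda B+C)^{-1}\,d\lambda,$$ where $\Gamma$ is a contour in $\mathbb C$, oriented counterclockwise and surrounding $\sigma(B,C)$. Then for all $t\in\mathbb R$ $$U(t)=\bigl(e^{Xt}-e^{Zt}\bigr)(X-Z)^{-1},\qquad U'(t)=\bigl(Xe^{Xt}-Ze^{Zt}\bigr)(X-Z)^{-1}.$$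
   Context: $\mathbf 1$ and $\mathbf 0$ denote the identity and zero matrices in $\mathbb C^{n\times n}$. The spectrum $\sigma(B,C)$ of the pencil $L(\lambda)=\lambda^2\mathbf 1+\lambda B+C$ is the set of all $\lambda\in\mathbb C$ for which the matrix $\lambda^2\mathbf1+\lambda B+C$ is not invertible. A matrix $X\in\mathbb C^{n\times n}$ is a right solvent of the pencil if $X^2+BX+C=\mathbf0$. Two right solvents $X$ and $Z$ form a complete pair if the matrix $X-Z$ is invertible. *)

(* Defs.v *)
From HB Require Import structures.
From mathcomp Require Import all_boot all_order all_algebra.
From mathcomp Require Import all_classical all_reals all_analysis.
From mathcomp Require Import complex.

Set Implicit Arguments.
Unset Strict Implicit.
Unset Printing Implicit Defensive.

Import Order.TTheory GRing.Theory Num.Theory.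
Import numFieldNormedType.Exports.

Local Open Scope classical_set_scope.
Local Open Scope ring_scope.

Section ComplexCalculus.
Variable R : realType.
Implicit Types (a b t : R) (f : R -> R[i]).

Definition is_deriveC f t (df : R[i]) : Prop :=
  is_derive t 1 (fun s => complex.Re (f s)) (complex.Re df) /\
  is_derive t 1 (fun s => complex.Im (f s)) (complex.Im df).

Definition derive1C f t : R[i] :=
  (derive1 (fun s => complex.Re (f s)) t +i*
   derive1 (fun s => complex.Im (f s)) t)%C.

Definition integralC a b f : R[i] :=
  ((\int[lebesgue_measure]_(s in `[a, b]) complex.Re (f s)) +i*
   (\int[lebesgue_measure]_(s in `[a, b]) complex.Im (f s)))%C.

Definition expC (z : R[i]) : R[i] :=
  ((expR (complex.Re z) * cos (complex.Im z)) +i*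
   (expR (complex.Re z) * sin (complex.Im z)))%C.

(* Continuously differentiable on `]a, b[, the function and its derivative
   having continuous extensions to `[a, b]; by the mean value theorem this is
   C^1 on `[a, b] with one-sided derivatives at the endpoints. *)
Definition C1_on a b (g : R -> R) : Prop :=
  derivable_oo_LRcontinuous g a b /\
  exists2 dg : R -> R,
    {within `[a, b], continuous dg} & {in `]a, b[, derive1 g =1 dg}.

Definition piecewise_C1 a b f : Prop :=
  exists2 s : seq R, itv_partition a b s &
    forall k, (k < size s)%N ->
      C1_on (nth a (a :: s) k) (nth a s k) (fun t => complex.Re (f t)) /\
      C1_on (nth a (a :: s) k) (nth a s k) (fun t => complex.Im (f t)).

Record contour := Contour {
  contour_start : R;
  contour_end : R;
  contour_path :> R -> R[i];
  contour_lt : contour_start < contour_end;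
  contour_piecewise_C1 : piecewise_C1 contour_start contour_end contour_path;
  contour_closed : contour_path contour_start = contour_path contour_end
}.

Implicit Type G : contour.

Definition contour_support G : set R[i] :=
  [set G s | s in `[contour_start G, contour_end G]].

(* The finitely many breakpoints, where derive1C is meaningless, are
   negligible for the integral. *)
Definition contour_integral G (F : R[i] -> R[i]) : R[i] :=
  integralC (contour_start G) (contour_end G)
    (fun s => F (G s) * derive1C G s).

Definition two_pi_i : R[i] := (0 +i* (2 * pi))%C.

Definition winding_number G (z : R[i]) : R[i] :=
  two_pi_i^-1 * contour_integral G (fun w => (w - z)^-1).

(* G is oriented counterclockwise and surrounds S; G need not be simple. *)
Definition surrounds G (S : set R[i]) : Prop :=
  contour_support G `&` S = set0 /\
  forall z, S z -> winding_number G z = 1.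

Definition mx_contour_integral G (m n : nat) (F : R[i] -> 'M[R[i]]_(m, n)) :
    'M[R[i]]_(m, n) :=
  \matrix_(i, j) contour_integral G (fun w => F w i j).

Definition is_derive_mx (m n : nat) (F : R -> 'M[R[i]]_(m, n)) t
    (dF : 'M[R[i]]_(m, n)) : Prop :=
  forall i j, is_deriveC (fun s => F s i j) t (dF i j).

End ComplexCalculus.

(* Stated over an abstract numFieldType K, which carries the norm topology;
   it is used at K := R[i], which has no topology instance of its own. *)
Definition expmx (K : numFieldType) (n : nat) (A : 'M[K]_n) : 'M[K]_n :=
  lim (series (fun k : nat => (k`!%:R : K)^-1 *: A ^+ k) @ \oo).

Section Pencil.
Variables (R : realType) (n : nat).
Implicit Types A B C X Z : 'M[R[i]]_n.

Definition pencil B C (l : R[i]) : 'M[R[i]]_n := (l ^+ 2)%:M + l *: B + C.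

Definition pencil_spectrum B C : set R[i] :=
  [set l | pencil B C l \notin unitmx].

Definition right_solvent B C X : Prop := X ^+ 2 + B *m X + C = 0.

Definition complete_pair X Z : Prop := X - Z \in unitmx.

End Pencil.

(* Main.v *)
Require Import Defs.
From HB Require Import structures.
From mathcomp Require Import all_boot all_order all_algebra.
From mathcomp Require Import all_classical all_reals all_analysis.
From mathcomp Require Import complex.
From mathcomp Require Import measurable_realfun.
From mathcomp Require Import ring lra.

(* Since L(w) = w^2 + w B + C factors as (w + X + B)(w - X), and likewise with Z,
   the spectra of X and Z lie in that of the pencil and
   L(w)^-1 (X - Z) = (w - X)^-1 - (w - Z)^-1 off it. It remains to show that
   V(t) = (2 pi i)^-1 \oint e^(wt) (w - X)^-1 dw equals e^(tX). From
   w (w - X)^-1 = 1 + X (w - X)^-1 and \oint e^(wt) dw = 0 one gets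
   V' = X V = V X, so that V(-t) V(t) and V(-t) e^(tX) are constant, equal to
   V(0). Finally V(0) = 1: interpolating w |-> (w - X)^-1 at the roots of the
   characteristic polynomial (Newton's form), only the term 1/(w - z) contributes,
   because a product of at least two factors 1/(w - z_i) integrates to zero along
   a contour of winding number 1 around every z_i. *)

Set Implicit Arguments.
Unset Strict Implicit.
Unset Printing Implicit Defensive.

Import Order.TTheory GRing.Theory Num.Theory.
Import numFieldNormedType.Exports.

Local Open Scope classical_set_scope.
Local Open Scope ring_scope.

(** * Bounded measurable functions and the fundamental theorem on a partition *)

Section BoundedMeasurable.
Variable R : realType.
Implicit Types (a b c : R) (f g h : R -> R).

(** Cauchy's theorem is never invoked: every vanishing integral comes from an explicit primitive
    pulled back to the contour, and winding numbers enter only through a single fraction 1/(w - z).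
    Newton's form covers simple and repeated eigenvalues by one formula, without Jordan form;
    Cayley-Hamilton makes it exact. The analytic obstacle is that [derive1C G] is arbitrary at the
    breakpoints, so integrands carrying it are not continuous. The working class is therefore that
    of bounded measurable functions on a segment: they are integrable, stable under sums and
    products, and insensitive to the values at finitely many points. Continuity is asked only of the
    factor multiplying [derive1C G]. The detour through V(-t) is there because V(t) is not known
    beforehand to be invertible: V(-t) V(t) = 1 supplies an invertible factor, which is then
    cancelled from V(-t) V(t) = V(-t) e^(tX). *)

Definition bounded_measurable a b f :=
  measurable_fun `[a, b] f /\
  exists M : R, forall x, x \in `[a, b] -> `|f x| <= M.

Lemma bounded_measurable_integrable a b f : bounded_measurable a b f ->
  lebesgue_measure.-integrable `[a, b] (EFin \o f).
Proof.
move=> [mf [M fM]]; apply: measurable_bounded_integrable => //.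
  by apply: compact_finite_measure; exact: segment_compact.
by exists M; split; [exact: num_real|move=> N MN x /fM /le_trans; apply; exact: ltW].
Qed.

Lemma bounded_measurableD a b f g : bounded_measurable a b f ->
  bounded_measurable a b g -> bounded_measurable a b (fun x => f x + g x).
Proof.
move=> [mf [M fM]] [mg [N gN]]; split; first exact: measurable_funD.
exists (M + N) => x xab; apply: (le_trans (ler_normD _ _)).
by apply: lerD; [exact: fM|exact: gN].
Qed.

Lemma bounded_measurableM a b f g : bounded_measurable a b f ->
  bounded_measurable a b g -> bounded_measurable a b (fun x => f x * g x).
Proof.
move=> [mf [M fM]] [mg [N gN]]; split; first exact: measurable_funM.
exists (M * N) => x xab; rewrite normrM.
by apply: ler_pM => //; [exact: fM|exact: gN].
Qed.

Lemma bounded_measurableN a b f : bounded_measurable a b f ->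
  bounded_measurable a b (fun x => - f x).
Proof.
move=> [mf [M fM]]; split; first exact: measurable_funN.
by exists M => x xab; rewrite normrN fM.
Qed.

Lemma bounded_measurableB a b f g : bounded_measurable a b f ->
  bounded_measurable a b g -> bounded_measurable a b (fun x => f x - g x).
Proof. by move=> mf mg; apply: bounded_measurableD => //; exact: bounded_measurableN. Qed.

Lemma continuous_bounded_measurable a b f : {within `[a, b], continuous f} ->
  bounded_measurable a b f.
Proof.
move=> cf; split; first exact: subspace_continuous_measurable_fun.
have [ab|ba] := leP a b; last first.
  by exists 0 => x; rewrite in_itv/= => /andP[ax /(le_trans ax)]; rewrite leNgt ba.
have cn : {within `[a, b], continuous (fun x => `|f x|)}.
  by move=> x; apply: cvg_norm; exact: cf.
have [c _ fc] := EVT_max ab cn.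
by exists `|f c|.
Qed.

Lemma itv_cc_split a b c : a <= c -> c <= b ->
  `[a, b]%classic = `[a, c] `|` `[c, b] :> set R.
Proof.
move=> ac cb; apply/seteqP; split => x /=; rewrite !in_itv/=.
  by move=> /andP[ax xb]; have [xc|/ltW cx] := leP x c; [left|right];
    rewrite ?ax ?xc ?cx.
by move=> [] /andP[? ?]; apply/andP; split=> //; lra.
Qed.

Lemma bounded_measurable_split a b c f : a <= c -> c <= b ->
  bounded_measurable a c f -> bounded_measurable c b f ->
  bounded_measurable a b f.
Proof.
move=> ac cb [mf [M fM]] [mg [N gN]]; split.
  by rewrite (itv_cc_split ac cb); apply/measurable_funU.
exists (Num.max M N) => x xab; rewrite le_max.
have : (`[a, c] `|` `[c, b]) x by rewrite -itv_cc_split.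
by move=> [/fM -> //|/gN ->]; rewrite orbT.
Qed.

(** Singletons are measurable and two extra values keep a function bounded. This absorbs the
    arbitrary value of a derivative at the ends of a smooth piece. *)
Lemma eq_in_bounded_measurable a b f g : {in `]a, b[, f =1 g} ->
  bounded_measurable a b g -> bounded_measurable a b f.
Proof.
move=> fg [mg [M gM]]; split; last first.
  exists (Num.max M (Num.max `|f a| `|f b|)) => x xab.
  have := xab; rewrite in_itv/= => /andP[ax xb].
  rewrite !le_max.
  move: ax; rewrite le_eqVlt => /predU1P[<-|ax]; first by rewrite lexx !orbT.
  move: xb; rewrite le_eqVlt => /predU1P[->|xb]; first by rewrite lexx !orbT.
  by rewrite fg ?in_itv/= ?ax ?xb// gM.
have [ab|ba] := leP a b; last first.
  by rewrite set_itv_ge ?bnd_simp -?ltNge//; exact: measurable_fun_set0.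
have -> : `[a, b]%classic = `]a, b[ `|` ([set a] `|` [set b]) :> set R.
  apply/seteqP; split => x /=; rewrite !in_itv/=.
    move=> /andP[]; rewrite !le_eqVlt => /predU1P[<-|ax]; first by right; left.
    move=> /predU1P[->|xb]; first by right; right.
    by left; rewrite ax xb.
  by move=> [/andP[/ltW -> /ltW ->]//|[->|->]]; rewrite ?lexx ?ab.
apply/measurable_funU => //; first exact: measurableU.
split; last first.
  by apply/measurable_funU => //; split; exact: measurable_fun_set1.
apply: (@eq_measurable_fun _ _ _ _ _ g).
  by move=> x; rewrite inE/= => /fg ->.
by apply: measurable_funS mg => //; exact: subset_itv_oo_cc.
Qed.

Lemma Rintegral_split a b c f : a <= c -> c <= b ->
  bounded_measurable a b f ->
  \int[lebesgue_measure]_(x in `[a, b]) f x =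
  \int[lebesgue_measure]_(x in `[a, c]) f x +
  \int[lebesgue_measure]_(x in `[c, b]) f x.
Proof.
move=> ac cb /bounded_measurable_integrable fi.
have := @Rintegral_itvB _ f (BLeft a) (BRight b) c fi.
rewrite !bnd_simp => /(_ ac cb) H.
(* The library difference formula yields the half-open []c, b]]; the point [c] has measure zero. *)
rewrite -(Rintegral_itv_obnd_cbnd (r := c)) -?H; first by rewrite addrC subrK.
by apply: integrableS fi => //; apply: subset_itvr; rewrite bnd_simp.
Qed.

(* [df] is required to be continuous up to the endpoints, although it is the
   derivative of [f] only in the interior. *)
Definition C1_pair a b f df :=
  [/\ {within `[a, b], continuous f}, {within `[a, b], continuous df} &
      {in `]a, b[, forall x, is_derive (x : R) (1 : R) f (df x)}].

(** [h] stands for the integrand as it is actually written, with [derive1] in it; it agrees with the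
    continuous [df] except at the two endpoints, which are null. *)
Lemma C1_pair_FTC a b f df h : a < b -> C1_pair a b f df ->
  {in `]a, b[, h =1 df} ->
  bounded_measurable a b h /\
  \int[lebesgue_measure]_(x in `[a, b]) h x = f b - f a.
Proof.
move=> ab [cf cdf fdf] hdf.
have bdf := continuous_bounded_measurable cdf.
have bh := eq_in_bounded_measurable hdf bdf.
split=> //.
have -> : \int[lebesgue_measure]_(x in `[a, b]) h x =
          \int[lebesgue_measure]_(x in `[a, b]) df x.
  rewrite /Rintegral; congr fine; apply: eq_integral_itv_bounded => //.
    by apply: measurable_funS bh.1 => //; exact: subset_itv_oo_cc.
  by apply: measurable_funS bdf.1 => //; exact: subset_itv_oo_cc.
rewrite /Rintegral (@continuous_FTC2 _ df f)//.
- have /(continuous_within_itvP _ ab)[_ fa fb] := cf.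
  by split => // x xab; have xd := fdf x xab; exact: ex_derive.
- by move=> x xab; have xd := fdf x xab; rewrite derive1E; exact: derive_val.
Qed.

(** The increments of [f] over the pieces telescope, as [f] has one value at each breakpoint whereas
    [h] is uncontrolled there. *)
Lemma partition_FTC (s : seq R) a b f h : itv_partition a b s ->
  (forall k, (k < size s)%N -> exists2 df,
     C1_pair (nth a (a :: s) k) (nth a s k) f df &
     {in `](nth a (a :: s) k), (nth a s k)[, h =1 df}) ->
  bounded_measurable a b h /\
  \int[lebesgue_measure]_(x in `[a, b]) h x = f b - f a.
Proof.
elim: s a => [a /itv_partition_nil <- _|c s IH a pab H].
  rewrite set_itv1 subrr; split; last first.
    by rewrite /Rintegral integral_set1.
  split; first by rewrite set_itv1; exact: measurable_fun_set1.
  by exists `|h a| => x; rewrite in_itv/= => /andP[ax xa]; rewrite (@le_anti _ _ x a) ?ax ?xa.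
have pcb := itv_partition_cons pab.
have ac : a < c by case: pab => /= /andP[].
have cb := itv_partition_le pcb.
have [df fdf hdf] := H 0%N isT.
have [bac iac] := C1_pair_FTC ac fdf hdf.
have [k ks|bcb icb] := IH c pcb.
  have [dg fdg hdg] := H k.+1 ks.
  (* Dropping the head of the partition changes the default of [nth] from [a] to [c], harmlessly,
     since the indices stay in range. *)
  exists dg; first by move: fdg; rewrite /= !(set_nth_default c a) //= ltnW.
  by move: hdg; rewrite /= !(set_nth_default c a) //= ltnW.
have bab := bounded_measurable_split (ltW ac) cb bac bcb.
split=> //; rewrite (Rintegral_split (ltW ac) cb)//= iac icb; lra.
Qed.

Lemma partition_continuous (s : seq R) a b f : itv_partition a b s ->
  (forall k, (k < size s)%N ->
     {within `[nth a (a :: s) k, nth a s k], continuous f}) ->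
  {within `[a, b], continuous f}.
Proof.
elim: s a => [a /itv_partition_nil <- _|c s IH a pab H].
  by rewrite set_itv1; exact: continuous_subspace1.
have pcb := itv_partition_cons pab.
have ac : a < c by case: pab => /= /andP[].
have cb := itv_partition_le pcb.
rewrite (itv_cc_split (ltW ac) cb); apply: withinU_continuous.
- exact: itv_closed.
- exact: itv_closed.
- exact: (H 0%N isT).
- apply: IH => // k ks; have := H k.+1 ks.
  by rewrite /= !(set_nth_default c a) //= ltnW.
Qed.

End BoundedMeasurable.

(** * Complex-valued functions of a real variable *)

Section ComplexFunctions.
Variable R : realType.
Implicit Types (a b c d t : R) (f g : R -> R[i]) (x y z w : R[i]).

Local Notation Re := (@complex.Re R).
Local Notation Im := (@complex.Im R).

Lemma complex_eq x y : Re x = Re y -> Im x = Im y -> x = y.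
Proof. by case: x y => [? ?] [? ?] /= -> ->. Qed.

Lemma ReD x y : Re (x + y) = Re x + Re y.
Proof. by case: x y => [? ?] [? ?]. Qed.

Lemma ImD x y : Im (x + y) = Im x + Im y.
Proof. by case: x y => [? ?] [? ?]. Qed.

Lemma ReN x : Re (- x) = - Re x.
Proof. by case: x. Qed.

Lemma ImN x : Im (- x) = - Im x.
Proof. by case: x. Qed.

Lemma ReM x y : Re (x * y) = Re x * Re y - Im x * Im y.
Proof. by case: x y => [? ?] [? ?]. Qed.

Lemma ImM x y : Im (x * y) = Re x * Im y + Im x * Re y.
Proof. by case: x y => [? ?] [? ?]. Qed.

Lemma ReV x : Re x^-1 = Re x * (Re x * Re x + Im x * Im x)^-1.
Proof. by case: x. Qed.

Lemma ImV x : Im x^-1 = - (Im x * (Re x * Re x + Im x * Im x)^-1).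
Proof. by case: x. Qed.

Lemma norm2_neq0 x : x != 0 -> Re x * Re x + Im x * Im x != 0.
Proof.
case: x => [p q]; rewrite eq_complex /= => pq.
by rewrite -!expr2 paddr_eq0 ?sqr_ge0// !sqrf_eq0.
Qed.

Lemma expC0 : expC 0 = 1 :> R[i].
Proof. by rewrite /expC/= expR0 cos0 sin0 mulr1 mulr0. Qed.

Lemma derive1C_val f t x : is_deriveC f t x -> derive1C f t = x.
Proof.
move=> [rx ix]; apply: complex_eq; rewrite /derive1C/= derive1E.
  exact: (@derive_val _ _ _ _ _ _ _ rx).
exact: (@derive_val _ _ _ _ _ _ _ ix).
Qed.

Lemma is_deriveC_cst x t : is_deriveC (fun=> x) t 0.
Proof. by split; exact: is_derive_cst. Qed.

Lemma is_deriveC_real t : is_deriveC (fun s => s%:C%C) t 1.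
Proof. by split; [exact: is_derive_id|exact: is_derive_cst]. Qed.

Lemma is_deriveCD f g t x y : is_deriveC f t x -> is_deriveC g t y ->
  is_deriveC (fun s => f s + g s) t (x + y).
Proof.
move=> [fr fi] [gr gi]; split.
  rewrite (_ : (fun s => _) = (fun s => Re (f s)) + (fun s => Re (g s))); last first.
    by apply/funext => s; rewrite -[LHS]/(Re _) ReD.
  by rewrite -[complex.Re _]/(Re _) ReD; exact: is_deriveD.
rewrite (_ : (fun s => _) = (fun s => Im (f s)) + (fun s => Im (g s))); last first.
  by apply/funext => s; rewrite -[LHS]/(Im _) ImD.
by rewrite -[complex.Im _]/(Im _) ImD; exact: is_deriveD.
Qed.

Lemma is_deriveCM f g t x y : is_deriveC f t x -> is_deriveC g t y ->
  is_deriveC (fun s => f s * g s) t (x * g t + f t * y).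
Proof.
move=> [fr fi] [gr gi]; split.
  rewrite (_ : (fun s => _) = (fun s => Re (f s)) * (fun s => Re (g s)) -
      (fun s => Im (f s)) * (fun s => Im (g s))); last first.
    by apply/funext => s; rewrite -[LHS]/(Re _) ReM.
  apply: (is_derive_eq (is_deriveB (is_deriveM fr gr) (is_deriveM fi gi))).
  rewrite -[RHS]/(Re _) ReD !ReM /GRing.scale/= /Re /Im; ring.
rewrite (_ : (fun s => _) = (fun s => Re (f s)) * (fun s => Im (g s)) +
    (fun s => Im (f s)) * (fun s => Re (g s))); last first.
  by apply/funext => s; rewrite -[LHS]/(Im _) ImM.
apply: (is_derive_eq (is_deriveD (is_deriveM fr gi) (is_deriveM fi gr))).
rewrite -[RHS]/(Im _) ImD !ImM /GRing.scale/= /Re /Im; ring.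
Qed.

Lemma is_deriveCZ f t x y : is_deriveC f t x ->
  is_deriveC (fun s => y * f s) t (y * x).
Proof.
move=> fx; have := is_deriveCM (is_deriveC_cst y t) fx.
by rewrite mul0r add0r.
Qed.

Lemma is_deriveC_sum n (F : 'I_n -> R -> R[i]) t (dF : 'I_n -> R[i]) :
  (forall k, is_deriveC (F k) t (dF k)) ->
  is_deriveC (fun s => \sum_k F k s) t (\sum_k dF k).
Proof.
elim: n F dF => [|n IH] F dF H.
  rewrite big_ord0 (_ : (fun s => _) = fun=> 0); first exact: is_deriveC_cst.
  by apply/funext => s; rewrite big_ord0.
rewrite big_ord_recl (_ : (fun s => _) =
  fun s => F ord0 s + \sum_(k < n) F (lift ord0 k) s); last first.
  by apply/funext => s; rewrite big_ord_recl.
by apply: is_deriveCD => //; apply: IH => k; exact: H.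
Qed.

Lemma is_deriveCV f t x : f t != 0 -> is_deriveC f t x ->
  is_deriveC (fun s => (f s)^-1) t (- (f t)^-2 * x).
Proof.
move=> ft0 [fr fi]; have N0 := norm2_neq0 ft0.
(* [N] is the squared modulus of [f]: the real and imaginary parts of the inverse are Re f / N and -
   Im f / N, so the real quotient rule applies to each. *)
pose N := (fun s => Re (f s)) * (fun s => Re (f s)) +
      (fun s => Im (f s)) * (fun s => Im (f s)).
have dN := is_deriveV (f := N) N0 (is_deriveD (is_deriveM fr fr) (is_deriveM fi fi)).
rewrite -exprVn expr2.
split.
  rewrite (_ : (fun s => _) = (fun s => Re (f s)) * (fun s => (N s)^-1)); last first.
    by apply/funext => s; rewrite -[LHS]/(Re _) ReV.
  apply: (is_derive_eq (is_deriveM fr dN)).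
  rewrite -[RHS]/(Re _) !(ReM,ReN,ImN,ImM,ReV,ImV) /GRing.scale/= /N.
  by rewrite -![(_ * _ + _ * _) t]/(_ * _ + _ * _) /Re /Im in N0 *; field.
rewrite (_ : (fun s => _) = - ((fun s => Im (f s)) * (fun s => (N s)^-1))); last first.
  by apply/funext => s; rewrite -[LHS]/(Im _) ImV.
apply: (is_derive_eq (is_deriveN (is_deriveM fi dN))).
rewrite -[RHS]/(Im _) !(ReM,ReN,ImN,ImM,ReV,ImV) /GRing.scale/= /N.
by rewrite -![(_ * _ + _ * _) t]/(_ * _ + _ * _) /Re /Im in N0 *; field.
Qed.

Lemma is_deriveC_exp f t x : is_deriveC f t x ->
  is_deriveC (fun s => expC (f s)) t (expC (f t) * x).
Proof.
move=> [fr fi].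
have de := is_derive1_comp (is_derive_expR (Re (f t))) fr.
have dc := is_derive1_comp (is_derive_cos (Im (f t))) fi.
have ds := is_derive1_comp (is_derive_sin (Im (f t))) fi.
split.
  apply: (is_derive_eq (is_deriveM de dc)).
  rewrite -[RHS]/(Re _) ReM /GRing.scale/= /Re /Im/=; ring.
apply: (is_derive_eq (is_deriveM de ds)).
rewrite -[RHS]/(Im _) ImM /GRing.scale/= /Re /Im/=; ring.
Qed.

Definition continuousC_on a b f :=
  {within `[a, b], continuous (fun s => Re (f s))} /\
  {within `[a, b], continuous (fun s => Im (f s))}.

Lemma continuousC_on_cst a b x : continuousC_on a b (fun=> x).
Proof. by split=> s; exact: cvg_cst. Qed.

Lemma continuousC_onD a b f g : continuousC_on a b f -> continuousC_on a b g ->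
  continuousC_on a b (fun s => f s + g s).
Proof.
move=> [fr fi] [gr gi]; split.
  rewrite (_ : (fun s => _) = fun s => Re (f s) + Re (g s)).
    by move=> s; apply: cvgD; [exact: fr|exact: gr].
  by apply/funext => s; exact: ReD.
rewrite (_ : (fun s => _) = fun s => Im (f s) + Im (g s)).
  by move=> s; apply: cvgD; [exact: fi|exact: gi].
by apply/funext => s; exact: ImD.
Qed.

Lemma continuousC_onM a b f g : continuousC_on a b f -> continuousC_on a b g ->
  continuousC_on a b (fun s => f s * g s).
Proof.
move=> [fr fi] [gr gi]; split.
  rewrite (_ : (fun s => _) = fun s => Re (f s) * Re (g s) - Im (f s) * Im (g s)).
    by move=> s; apply: cvgB; apply: cvgM;
      [exact: fr|exact: gr|exact: fi|exact: gi].
  by apply/funext => s; exact: ReM.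
rewrite (_ : (fun s => _) = fun s => Re (f s) * Im (g s) + Im (f s) * Re (g s)).
  by move=> s; apply: cvgD; apply: cvgM;
    [exact: fr|exact: gi|exact: fi|exact: gr].
by apply/funext => s; exact: ImM.
Qed.

Lemma continuousC_on_exp a b f : continuousC_on a b f ->
  continuousC_on a b (fun s => expC (f s)).
Proof.
move=> [fr fi]; split=> s; apply: cvgM.
- by apply: continuous_cvg; [exact: continuous_expR|exact: fr].
- by apply: continuous_cvg; [exact: continuous_cos|exact: fi].
- by apply: continuous_cvg; [exact: continuous_expR|exact: fr].
- by apply: continuous_cvg; [exact: continuous_sin|exact: fi].
Qed.

Lemma continuousC_onV a b f : (forall s, s \in `[a, b] -> f s != 0) ->
  continuousC_on a b f -> continuousC_on a b (fun s => (f s)^-1).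
Proof.
move=> f0 [fr fi].
have nV : {within `[a, b], continuous
    (fun s => (Re (f s) * Re (f s) + Im (f s) * Im (f s))^-1)}.
  (* [f] may vanish outside [[a, b]], so continuity of the quotient is checked only at points of the
     segment. *)
  apply/subspace_continuousP => s sab.
  apply: cvgV; first by apply: norm2_neq0; exact: f0.
  have /subspace_continuousP/(_ _ sab) fr' := fr.
  have /subspace_continuousP/(_ _ sab) fi' := fi.
  by apply: cvgD; exact: cvgM.
split.
  rewrite (_ : (fun s => _) = fun s => Re (f s) * (Re (f s) * Re (f s) + Im (f s) * Im (f s))^-1).
    by move=> s; apply: cvgM; [exact: fr|exact: nV].
  by apply/funext => s; exact: ReV.
rewrite (_ : (fun s => _) = fun s => - (Im (f s) * (Re (f s) * Re (f s) + Im (f s) * Im (f s))^-1)).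
  by move=> s; apply: cvgN; apply: cvgM; [exact: fi|exact: nV].
by apply/funext => s; exact: ImV.
Qed.

End ComplexFunctions.

(** * Contour integrals *)

Section ContourIntegral.
Variable R : realType.
Implicit Types (a b c d t : R) (f g df dg : R -> R[i]) (z w : R[i]).
Local Notation Re := (@complex.Re R).
Local Notation Im := (@complex.Im R).

Definition bounded_measurableC a b f :=
  bounded_measurable a b (fun s => Re (f s)) /\
  bounded_measurable a b (fun s => Im (f s)).

Lemma bounded_measurableCM a b f g : bounded_measurableC a b f ->
  bounded_measurableC a b g -> bounded_measurableC a b (fun s => f s * g s).
Proof.
move=> [fr fi] [gr gi]; split.
  rewrite (_ : (fun s => _) = fun s => Re (f s) * Re (g s) - Im (f s) * Im (g s)).
    by apply: bounded_measurableB; exact: bounded_measurableM.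
  by apply/funext => s; exact: ReM.
rewrite (_ : (fun s => _) = fun s => Re (f s) * Im (g s) + Im (f s) * Re (g s)).
  by apply: bounded_measurableD; exact: bounded_measurableM.
by apply/funext => s; exact: ImM.
Qed.

Lemma continuousC_bounded_measurable a b f : continuousC_on a b f ->
  bounded_measurableC a b f.
Proof. by move=> [fr fi]; split; exact: continuous_bounded_measurable. Qed.

Lemma integralCD a b f g : bounded_measurableC a b f ->
  bounded_measurableC a b g ->
  integralC a b (fun s => f s + g s) = integralC a b f + integralC a b g.
Proof.
move=> [fr fi] [gr gi]; apply: complex_eq.
  rewrite ReD /integralC/= -RintegralD//; try exact: bounded_measurable_integrable.
  by apply: eq_Rintegral => s _; rewrite ReD.
rewrite ImD /integralC/= -RintegralD//; try exact: bounded_measurable_integrable.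
by apply: eq_Rintegral => s _; rewrite ImD.
Qed.

Lemma integralCZ a b f z : bounded_measurableC a b f ->
  integralC a b (fun s => z * f s) = z * integralC a b f.
Proof.
move=> [/bounded_measurable_integrable fr /bounded_measurable_integrable fi].
have iZ (r : R) h : lebesgue_measure.-integrable `[a, b] (EFin \o h) ->
    lebesgue_measure.-integrable `[a, b] (EFin \o (fun s => r * h s)).
  by move=> ih; rewrite (_ : _ \o _ = (fun s => r%:E * (h s)%:E)%E)//; exact: integrableZl.
apply: complex_eq.
  rewrite ReM /integralC/= -!RintegralZl// -RintegralB//; try exact: iZ.
  by apply: eq_Rintegral => s _; rewrite ReM.
rewrite ImM /integralC/= -!RintegralZl// -RintegralD//; try exact: iZ.
by apply: eq_Rintegral => s _; rewrite ImM.
Qed.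

Definition C1C_pair a b f df :=
  [/\ continuousC_on a b f, continuousC_on a b df &
      {in `]a, b[, forall s : R, is_deriveC f s (df s)}].

Lemma C1C_pair_cst a b z : C1C_pair a b (fun=> z) (fun=> 0).
Proof.
split; [exact: continuousC_on_cst|exact: continuousC_on_cst|].
by move=> s _; exact: is_deriveC_cst.
Qed.

Lemma C1C_pairD a b f df g dg : C1C_pair a b f df -> C1C_pair a b g dg ->
  C1C_pair a b (fun s => f s + g s) (fun s => df s + dg s).
Proof.
move=> [cf cdf fdf] [cg cdg gdg]; split; [exact: continuousC_onD..|].
by move=> s sab; apply: is_deriveCD; [exact: fdf|exact: gdg].
Qed.

Lemma C1C_pairM a b f df g dg : C1C_pair a b f df -> C1C_pair a b g dg ->
  C1C_pair a b (fun s => f s * g s) (fun s => df s * g s + f s * dg s).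
Proof.
move=> [cf cdf fdf] [cg cdg gdg]; split; first exact: continuousC_onM.
  by apply: continuousC_onD; exact: continuousC_onM.
by move=> s sab; apply: is_deriveCM; [exact: fdf|exact: gdg].
Qed.

Lemma C1C_pairV a b f df : (forall s, s \in `[a, b] -> f s != 0) ->
  C1C_pair a b f df ->
  C1C_pair a b (fun s => (f s)^-1) (fun s => - (f s)^-2 * df s).
Proof.
move=> f0 [cf cdf fdf]; have cV := continuousC_onV f0 cf; split=> //.
  rewrite (_ : (fun s => _) = fun s => (-1) * ((f s)^-1 * (f s)^-1) * df s).
    by do !apply: continuousC_onM => //; exact: continuousC_on_cst.
  by apply/funext => s; rewrite mulN1r -exprVn expr2.
move=> s sab; apply: is_deriveCV; last exact: fdf.
by apply: f0; exact: subset_itv_oo_cc sab.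
Qed.

Lemma C1C_pair_exp a b f df : C1C_pair a b f df ->
  C1C_pair a b (fun s => expC (f s)) (fun s => expC (f s) * df s).
Proof.
move=> [cf cdf fdf]; have ce := continuousC_on_exp cf; split=> //.
  exact: continuousC_onM.
by move=> s sab; apply: is_deriveC_exp; exact: fdf.
Qed.

Lemma eq_C1C_pair a b f df f' df' : f =1 f' -> df =1 df' ->
  C1C_pair a b f df -> C1C_pair a b f' df'.
Proof. by move=> /funext -> /funext ->. Qed.

Lemma C1C_pairXn a b f df n : C1C_pair a b f df ->
  C1C_pair a b (fun s => f s ^+ n.+1) (fun s => n.+1%:R * f s ^+ n * df s).
Proof.
move=> H; elim: n => [|n IH].
  by apply: eq_C1C_pair H => s; rewrite ?expr1// expr0 !mul1r.
apply: eq_C1C_pair (C1C_pairM H IH) => s; first by rewrite -exprS.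
by rewrite [n.+2%:R]mulrSr (exprS _ n); ring.
Qed.

Variable G : contour R.
Local Notation a := (contour_start G).
Local Notation b := (contour_end G).
Local Notation supp := (contour_support G).
Implicit Types F dF : R[i] -> R[i].

(** On each piece [dg] is the continuous extension of the derivative supplied by [C1_on]. The
    inclusion of the pieces in [[a, b]] lets facts about the support be used piecewise. *)
Lemma contour_partition : exists2 s : seq R, itv_partition a b s &
  forall k, (k < size s)%N ->
    {subset `[nth a (a :: s) k, nth a s k] <= `[a, b]} /\
    exists dg, C1C_pair (nth a (a :: s) k) (nth a s k) G dg.
Proof.
have [s pab H] := contour_piecewise_C1 G; exists s => // k ks.
split.
  move=> x; rewrite !in_itv/= => /andP[kx xk].
  have := @itv_partition_nth_ge _ _ a b s k (ltnW ks) pab.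
  have := @itv_partition_nth_le _ _ a b s k.+1 ks pab.
  rewrite /= !(set_nth_default a b)//=; last exact: ltnW.
  by move=> ? ?; apply/andP; split; lra.
have [[dr [dgr cr er]] [di [dgi ci ei]]] := H k ks.
exists (fun t => (dgr t +i* dgi t)%C); split.
- by split; exact: derivable_oo_LRcontinuous_within.
- by split.
- move=> t tk; split.
  + apply: DeriveDef; first by case: dr => /(_ t tk).
    by rewrite -derive1E er.
  + apply: DeriveDef; first by case: di => /(_ t tk).
    by rewrite -derive1E ei.
Qed.

Lemma contour_supportP s : s \in `[a, b] -> supp (G s).
Proof. by move=> sab; exists s. Qed.

Lemma continuousC_contour : continuousC_on a b G.
Proof.
have [s pab H] := contour_partition.
by split; apply: (partition_continuous pab) => k ks;
  have [_ [dg [[? ?] _ _]]] := H k ks.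
Qed.

(* [dF] is the complex derivative of [F]; only its pullback along paths is
   needed. *)
Lemma contour_FTC F dF :
  (forall c d g dg, (forall s, s \in `[c, d] -> supp (g s)) ->
    C1C_pair c d g dg ->
    C1C_pair c d (fun s => F (g s)) (fun s => dF (g s) * dg s)) ->
  bounded_measurableC a b (fun s => dF (G s) * derive1C G s) /\
  contour_integral G dF = 0.
Proof.
move=> FdF; have [s pab H] := contour_partition.
have Hk k : (k < size s)%N -> exists2 dh : R -> R[i],
    C1C_pair (nth a (a :: s) k) (nth a s k) (fun t => F (G t)) dh &
    {in `](nth a (a :: s) k), (nth a s k)[,
      (fun t => dF (G t) * derive1C G t) =1 dh}.
  move=> ks; have [sub [dg Gdg]] := H k ks.
  exists (fun t => dF (G t) * dg t).
    by apply: FdF => // t /sub; exact: contour_supportP.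
  by move=> t tk /=; congr (_ * _); apply: derive1C_val; case: Gdg => _ _; exact.
have [k ks|bRe iRe] := @partition_FTC _ s a b (fun t => Re (F (G t)))
    (fun t => Re (dF (G t) * derive1C G t)) pab.
  have [dh [[cr _] [dr _] fdh] hdh] := Hk k ks.
  by exists (fun t => Re (dh t)); [split=> // t /fdh[]|move=> t /hdh ->].
have [k ks|bIm iIm] := @partition_FTC _ s a b (fun t => Im (F (G t)))
    (fun t => Im (dF (G t) * derive1C G t)) pab.
  have [dh [[_ cr] [_ dr] fdh] hdh] := Hk k ks.
  by exists (fun t => Im (dh t)); [split=> // t /fdh[]|move=> t /hdh ->].
split=> //; apply: complex_eq; rewrite /contour_integral /integralC/=.
  by rewrite iRe (contour_closed G) subrr.
by rewrite iIm (contour_closed G) subrr.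
Qed.

(** [derive1C G] is itself a pullback integrand, that of the constant 1 with primitive [id], so its
    regularity is a by-product of [contour_FTC]. *)
Lemma bounded_measurable_derive1_contour : bounded_measurableC a b (derive1C G).
Proof.
have [|bd _] := @contour_FTC id (fun=> 1).
  by move=> c d g dg _; apply: eq_C1C_pair => s //; rewrite mul1r.
rewrite (_ : derive1C G = fun s => 1 * derive1C G s)//.
by apply/funext => s; rewrite mul1r.
Qed.

(** Continuity is asked of the pullback only, so nothing is required of [F] off the contour and no
    topology on its domain is involved. *)
Definition contour_continuous F := continuousC_on a b (fun s => F (G s)).

Lemma contour_continuous_bounded F : contour_continuous F ->
  bounded_measurableC a b (fun s => F (G s) * derive1C G s).
Proof.
move=> cF; apply: bounded_measurableCM.
  exact: continuousC_bounded_measurable.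
exact: bounded_measurable_derive1_contour.
Qed.

Lemma contour_continuous_cst z : contour_continuous (fun=> z).
Proof. exact: continuousC_on_cst. Qed.

Lemma contour_continuousD F1 F2 : contour_continuous F1 ->
  contour_continuous F2 -> contour_continuous (fun w => F1 w + F2 w).
Proof. exact: continuousC_onD. Qed.

Lemma contour_continuousM F1 F2 : contour_continuous F1 ->
  contour_continuous F2 -> contour_continuous (fun w => F1 w * F2 w).
Proof. exact: continuousC_onM. Qed.

Lemma contour_continuous_id : contour_continuous id.
Proof. exact: continuousC_contour. Qed.

Lemma contour_continuous_exp t : contour_continuous (fun w => expC (w * t%:C%C)).
Proof.
apply: continuousC_on_exp.
exact: contour_continuousM contour_continuous_id (contour_continuous_cst _).
Qed.

Lemma contour_continuous_inv z : ~ supp z ->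
  contour_continuous (fun w => (w - z)^-1).
Proof.
move=> Sz; apply: continuousC_onV.
  move=> s sab; rewrite subr_eq0; apply/eqP => Gz; apply: Sz; rewrite -Gz.
  exact: contour_supportP.
exact: contour_continuousD contour_continuous_id (contour_continuous_cst _).
Qed.

Lemma contour_continuous_sum n (F : 'I_n -> R[i] -> R[i]) :
  (forall k, contour_continuous (F k)) ->
  contour_continuous (fun w => \sum_k F k w).
Proof.
elim: n F => [|n IH] F cF.
  rewrite (_ : (fun w => _) = fun=> 0); first exact: contour_continuous_cst.
  by apply/funext => s; rewrite big_ord0.
rewrite (_ : (fun w => _) = fun w => F ord0 w + \sum_(k < n) F (lift ord0 k) w).
  by apply: contour_continuousD => //; apply: IH => k; exact: cF.
by apply/funext => s; rewrite big_ord_recl.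
Qed.

Lemma eq_continuous_contour F1 F2 : {in supp, F1 =1 F2} ->
  contour_continuous F1 -> contour_continuous F2.
Proof.
move=> F12 [cr ci]; split.
  apply: subspace_eq_continuous cr => s /set_mem sab; congr (Re _).
  by apply: F12; apply: mem_set; exact: contour_supportP.
apply: subspace_eq_continuous ci => s /set_mem sab; congr (Im _).
by apply: F12; apply: mem_set; exact: contour_supportP.
Qed.

Lemma eq_contour_integral F1 F2 : {in supp, F1 =1 F2} ->
  contour_integral G F1 = contour_integral G F2.
Proof.
move=> F12.
have e s : s \in (`[a, b]%classic : set R) -> F1 (G s) = F2 (G s).
  by move=> /set_mem sab; apply: F12; apply: mem_set; exact: contour_supportP.
by apply: complex_eq; rewrite /contour_integral /integralC/=;
  apply: eq_Rintegral => s sab; rewrite (e s sab).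
Qed.

Lemma contour_integralD F1 F2 : contour_continuous F1 ->
  contour_continuous F2 -> contour_integral G (fun w => F1 w + F2 w) =
  contour_integral G F1 + contour_integral G F2.
Proof.
move=> c1 c2; rewrite /contour_integral -integralCD; try exact: contour_continuous_bounded.
by congr (integralC _ _ _); apply/funext => s; rewrite mulrDl.
Qed.

Lemma contour_integralZ F z : contour_continuous F ->
  contour_integral G (fun w => z * F w) = z * contour_integral G F.
Proof.
move=> cF; rewrite /contour_integral -integralCZ; last exact: contour_continuous_bounded.
by congr (integralC _ _ _); apply/funext => s; rewrite mulrA.
Qed.

Lemma contour_integral0 : contour_integral G (fun=> 0) = 0.
Proof.
rewrite -[RHS](mul0r (contour_integral G (fun=> 0))) -contour_integralZ.
  by apply: eq_contour_integral => w _; rewrite mul0r.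
exact: contour_continuous_cst.
Qed.

Lemma contour_integral_sum n (F : 'I_n -> R[i] -> R[i]) :
  (forall k, contour_continuous (F k)) ->
  contour_integral G (fun w => \sum_k F k w) = \sum_k contour_integral G (F k).
Proof.
elim: n F => [|n IH] F cF.
  rewrite big_ord0 -[RHS]contour_integral0; apply: eq_contour_integral => w _.
  by rewrite big_ord0.
rewrite big_ord_recl -IH// -contour_integralD//; last exact: contour_continuous_sum.
by apply: eq_contour_integral => w _; rewrite big_ord_recl.
Qed.

(** The primitive e^(wt)/t degenerates at t = 0, where the integrand is 1 and the primitive is w;
    hence the two cases. *)
Lemma contour_integral_exp t :
  contour_integral G (fun w => expC (w * t%:C%C)) = 0.
Proof.
have [->|t0] := eqVneq t 0.
  have [|_ <-] := @contour_FTC id (fun=> 1).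
    by move=> c d g dg _; apply: eq_C1C_pair => s //; rewrite mul1r.
  by apply: eq_contour_integral => w _; rewrite mulr0 expC0.
have t0' : t%:C%C != 0 :> R[i] by rewrite eq_complex/= negb_and t0.
have [|_ <-//] := @contour_FTC (fun w => t%:C%C^-1 * expC (w * t%:C%C))
  (fun w => expC (w * t%:C%C)).
move=> c d g dg _ H.
apply: eq_C1C_pair (C1C_pairM (C1C_pair_cst c d t%:C%C^-1)
  (C1C_pair_exp (C1C_pairM H (C1C_pair_cst c d t%:C%C)))) => s//.
by rewrite mul0r mulr0 add0r addr0; field.
Qed.

(** From exponent 2 on, a power of 1/(w - z) has the single-valued primitive - (w - z)^-(n+1) /
    (n+1) off [z]. Exponent 1 has none and is what the winding number measures. *)
Lemma contour_integral_inv_pow z n : ~ supp z ->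
  contour_integral G (fun w => (w - z)^-1 ^+ n.+2) = 0.
Proof.
move=> Sz.
have [|_ <-//] := @contour_FTC (fun w => - n.+1%:R^-1 * (w - z)^-1 ^+ n.+1)
  (fun w => (w - z)^-1 ^+ n.+2).
move=> c d g dg gS H.
have n0 : n.+1%:R != 0 :> R[i] by rewrite pnatr_eq0.
have g0 s : s \in `[c, d] -> g s + - z != 0.
  by move=> /gS sg; rewrite subr_eq0; apply/eqP => gz; apply: Sz; rewrite -gz.
apply: eq_C1C_pair (C1C_pairM (C1C_pair_cst c d (- n.+1%:R^-1)) (C1C_pairXn n
  (C1C_pairV g0 (C1C_pairD H (C1C_pair_cst c d (- z)))))) => s//.
rewrite mul0r add0r addr0 -exprVn.
by set v := (g s - z)^-1; rewrite !exprS; field.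
Qed.

End ContourIntegral.

(** * Integrals of products of simple fractions; the resolvent *)

Section MatrixContourIntegral.
Variables (R : realType) (G : contour R).
Local Notation supp := (contour_support G).
Implicit Types (w z : R[i]) (s : seq R[i]) (h : R[i] -> R[i]).

Definition contour_continuous_mx m n (F : R[i] -> 'M[R[i]]_(m, n)) :=
  forall i j, contour_continuous G (fun w => F w i j).

Lemma contour_continuous_mx_cst m n (A : 'M[R[i]]_(m, n)) :
  contour_continuous_mx (fun=> A).
Proof. by move=> i j; exact: contour_continuous_cst. Qed.

Lemma contour_continuous_mxD m n (F1 F2 : R[i] -> 'M[R[i]]_(m, n)) :
  contour_continuous_mx F1 -> contour_continuous_mx F2 ->
  contour_continuous_mx (fun w => F1 w + F2 w).
Proof.
move=> c1 c2 i j.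
rewrite (_ : (fun w => _) = fun w => F1 w i j + F2 w i j).
  exact: contour_continuousD.
by apply/funext => w; rewrite mxE.
Qed.

Lemma contour_continuous_mxZ m n h (F : R[i] -> 'M[R[i]]_(m, n)) :
  contour_continuous G h -> contour_continuous_mx F ->
  contour_continuous_mx (fun w => h w *: F w).
Proof.
move=> ch cF i j; rewrite (_ : (fun w => _) = fun w => h w * F w i j).
  exact: contour_continuousM.
by apply/funext => w; rewrite mxE.
Qed.

Lemma contour_continuous_mulmx m n p (F1 : R[i] -> 'M[R[i]]_(m, n))
    (F2 : R[i] -> 'M[R[i]]_(n, p)) :
  contour_continuous_mx F1 -> contour_continuous_mx F2 ->
  contour_continuous_mx (fun w => F1 w *m F2 w).
Proof.
move=> c1 c2 i j.
rewrite (_ : (fun w => _) = fun w => \sum_k F1 w i k * F2 w k j).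
  by apply: contour_continuous_sum => k; exact: contour_continuousM.
by apply/funext => w; rewrite mxE.
Qed.

Lemma eq_continuous_contour_mx m n (F1 F2 : R[i] -> 'M[R[i]]_(m, n)) :
  {in supp, F1 =1 F2} -> contour_continuous_mx F1 -> contour_continuous_mx F2.
Proof.
by move=> F12 c i j; apply: eq_continuous_contour (c i j) => w /F12 ->.
Qed.

Lemma eq_mx_contour_integral m n (F1 F2 : R[i] -> 'M[R[i]]_(m, n)) :
  {in supp, F1 =1 F2} -> mx_contour_integral G F1 = mx_contour_integral G F2.
Proof.
move=> F12; apply/matrixP => i j; rewrite !mxE.
by apply: eq_contour_integral => w /F12 ->.
Qed.

Lemma mx_contour_integralD m n (F1 F2 : R[i] -> 'M[R[i]]_(m, n)) :
  contour_continuous_mx F1 -> contour_continuous_mx F2 ->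
  mx_contour_integral G (fun w => F1 w + F2 w) =
  mx_contour_integral G F1 + mx_contour_integral G F2.
Proof.
move=> c1 c2; apply/matrixP => i j; rewrite !mxE -contour_integralD//.
by apply: eq_contour_integral => w _; rewrite mxE.
Qed.

Lemma mx_contour_integral_mull m n p (A : 'M[R[i]]_(m, n))
    (F : R[i] -> 'M[R[i]]_(n, p)) : contour_continuous_mx F ->
  mx_contour_integral G (fun w => A *m F w) = A *m mx_contour_integral G F.
Proof.
move=> cF; apply/matrixP => i j; rewrite !mxE.
under [RHS]eq_bigr do rewrite mxE -contour_integralZ//.
rewrite -contour_integral_sum; last first.
  by move=> k; apply: contour_continuousM => //; exact: contour_continuous_cst.
by apply: eq_contour_integral => w _; rewrite mxE.
Qed.

Lemma mx_contour_integral_mulr m n p (A : 'M[R[i]]_(n, p))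
    (F : R[i] -> 'M[R[i]]_(m, n)) : contour_continuous_mx F ->
  mx_contour_integral G (fun w => F w *m A) = mx_contour_integral G F *m A.
Proof.
move=> cF; apply/matrixP => i j; rewrite !mxE.
under [RHS]eq_bigr do rewrite mxE mulrC -contour_integralZ//.
rewrite -contour_integral_sum; last first.
  by move=> k; apply: contour_continuousM => //; exact: contour_continuous_cst.
by apply: eq_contour_integral => w _; rewrite mxE; apply: eq_bigr => k _; rewrite mulrC.
Qed.

Lemma mx_contour_integralZ m n h (A : 'M[R[i]]_(m, n)) :
  contour_continuous G h ->
  mx_contour_integral G (fun w => h w *: A) = contour_integral G h *: A.
Proof.
move=> ch; apply/matrixP => i j; rewrite !mxE mulrC -contour_integralZ//.
by apply: eq_contour_integral => w _; rewrite mxE mulrC.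
Qed.

(** The two clauses of [surrounds] at a single point, a form that passes from the spectrum of the
    pencil to the eigenvalues of a solvent. *)
Definition encircled z := ~ supp z /\ winding_number G z = 1.

Lemma two_pi_i_neq0 : two_pi_i R != 0.
Proof. by rewrite eq_complex/= negb_and mulf_neq0 ?orbT// gt_eqF// pi_gt0. Qed.

Definition inv_prod s w := \prod_(z <- s) (w - z)^-1.

Lemma contour_continuous_inv_prod s : (forall z, z \in s -> ~ supp z) ->
  contour_continuous G (inv_prod s).
Proof.
elim: s => [_|z s IH sS].
  rewrite (_ : inv_prod [::] = fun=> 1); first exact: contour_continuous_cst.
  by apply/funext => w; rewrite /inv_prod big_nil.
rewrite (_ : inv_prod _ = fun w => (w - z)^-1 * inv_prod s w).
  apply: contour_continuousM.
    by apply: contour_continuous_inv; apply: sS; rewrite mem_head.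
  by apply: IH => y ys; apply: sS; rewrite in_cons ys orbT.
by apply/funext => w; rewrite /inv_prod big_cons.
Qed.

(* Two distinct poles y, z are split by the partial fraction identity
   [1/((w-z)(w-y)) = (z-y)^-1 (1/(w-z) - 1/(w-y))]; a single multiple pole has a
   primitive. *)
Lemma contour_integral_inv_prod n s : size s = n.+1 ->
  (forall z, z \in s -> encircled z) ->
  contour_integral G (inv_prod s) = two_pi_i R *+ (n == 0%N).
Proof.
elim: n s => [|n IH] [|z s]//=.
  move=> [/size0nil ->] /(_ z (mem_head _ _))[_ wz].
  rewrite (_ : inv_prod _ = fun w => (w - z)^-1); last first.
    by apply/funext => w; rewrite /inv_prod big_seq1.
  move: wz; rewrite /winding_number => /(congr1 ( *%R (two_pi_i R))).
  by rewrite mulVKf ?two_pi_i_neq0// mulr1.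
move=> [sn] sE; have zE := sE z (mem_head _ _).
have [/all_pred1P sz|/allPn[y ys /= yz]] := boolP (all (pred1 z) s).
  rewrite mulr0n -(@contour_integral_inv_pow _ G z n zE.1) sz sn.
  congr contour_integral; apply/funext => w.
  by rewrite /inv_prod -[_ :: _]/(nseq n.+2 z) big_nseq iter_mulr_1.
have zy0 : z - y != 0 by rewrite subr_eq0 eq_sym.
pose r := rem y s.
have sr : size r = n by rewrite size_rem// sn.
have yr : perm_eq s (y :: r) := perm_to_rem ys.
have rE x : x \in r -> encircled x.
  by move=> xr; apply: sE; rewrite in_cons (mem_rem xr) orbT.
have yE : encircled y by apply: sE; rewrite in_cons ys orbT.
have zrE x : x \in z :: r -> encircled x.
  by rewrite in_cons => /predU1P[->//|/rE].
have yrE x : x \in y :: r -> encircled x.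
  by rewrite in_cons => /predU1P[->//|/rE].
have czr : contour_continuous G (inv_prod (z :: r)).
  by apply: contour_continuous_inv_prod => x /zrE[].
have cyr : contour_continuous G (inv_prod (y :: r)).
  by apply: contour_continuous_inv_prod => x /yrE[].
have cNyr : contour_continuous G (fun w => -1 * inv_prod (y :: r) w).
  by apply: contour_continuousM => //; exact: contour_continuous_cst.
transitivity (contour_integral G (fun w => (z - y)^-1 *
    (inv_prod (z :: r) w + -1 * inv_prod (y :: r) w))).
  apply: eq_contour_integral => w /set_mem wS.
  rewrite /inv_prod big_cons (perm_big _ yr) !big_cons /=.
  have wz : w - z != 0 by rewrite subr_eq0; apply/eqP => wz; apply: zE.1; rewrite -wz.
  have wy : w - y != 0 by rewrite subr_eq0; apply/eqP => wy; apply: yE.1; rewrite -wy.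
  by field; rewrite wz wy zy0.
rewrite contour_integralZ ?contour_integralD//; last exact: contour_continuousD.
rewrite contour_integralZ// (IH (z :: r)) /= ?sr// (IH (y :: r)) /= ?sr//.
by rewrite mulN1r subrr mulr0.
Qed.

End MatrixContourIntegral.

(** * Newton form of the matrix resolvent and its contour integral *)

Section Resolvent.
Variables (R : realType) (n : nat) (X : 'M[R[i]]_n.+1).
Implicit Types (w z : R[i]) (s : seq R[i]).

(* Newton interpolation of [(w - x)^-1] at the nodes [s], evaluated at the
   matrix [X]: the sum of [prod_(i < k) (X - s_i) / prod_(i <= k) (w - s_i)]. *)
Fixpoint newton_resolvent s w : 'M[R[i]]_n.+1 :=
  if s is z :: s' then (w - z)^-1 *: (1 + (X - z%:M) * newton_resolvent s' w)
  else 0.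

(** The product is the interpolation remainder. Adding a node [z] works because w - X and X - z
    commute and add up to the scalar w - z, which the prefactor cancels. *)
Lemma newton_resolventP s w : w \notin s ->
  (w%:M - X) * newton_resolvent s w =
  1 - \prod_(z <- s) ((w - z)^-1 *: (X - z%:M)).
Proof.
elim: s => [_|z s IH]; first by rewrite big_nil mulr0 subrr.
rewrite in_cons negb_or => /andP[wz ws]; rewrite big_cons /=.
have wz0 : w - z != 0 by rewrite subr_eq0.
have comm : (w%:M - X) * (X - z%:M) = (X - z%:M) * (w%:M - X).
  rewrite !mulrBl !mulrBr -!mulmxE !mul_scalar_mx !mul_mx_scalar.
  by rewrite !scale_scalar_mx [z * w]mulrC !opprD !opprK addrACA.
rewrite -scalerAr mulrDr mulr1 mulrA comm -mulrA IH// mulrBr mulr1 -scalerAl.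
rewrite [w%:M - X + _](_ : _ = (w - z)%:M - (X - z%:M) * 
    \prod_(j <- s) ((w - j)^-1 *: (X - j%:M))).
  by rewrite scalerBr scale_scalar_mx mulVf.
by rewrite raddfB/= !addrA; congr (_ - _); rewrite -!addrA addKr.
Qed.

(** Eigenvalues listed with algebraic multiplicity: over the distinct eigenvalues alone the product
    of the X - z would vanish only for diagonalizable X. *)
Definition char_roots : seq R[i] :=
  sval (closed_field_poly_normal (char_poly X)).

Lemma char_poly_roots : char_poly X = \prod_(z <- char_roots) ('X - z%:P).
Proof.
rewrite /char_roots; case: closed_field_poly_normal => r /= ->.
by have /monicP -> := char_poly_monic X; rewrite scale1r.
Qed.

Lemma prod_char_roots : \prod_(z <- char_roots) (X - z%:M) = 0.
Proof.
rewrite -(Cayley_Hamilton X) char_poly_roots rmorph_prod/=.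
by apply: eq_bigr => z _; rewrite rmorphB/= horner_mx_X horner_mx_C.
Qed.

Lemma char_roots_not_unit z : z \in char_roots -> z%:M - X \notin unitmx.
Proof.
move=> zr; have : eigenvalue X z.
  by rewrite eigenvalue_root_char char_poly_roots root_prod_XsubC.
move=> /eigenvalueP[v vX v0]; apply: contra v0 => u.
by rewrite -(mulmxK u v) mulmxBr vX mul_mx_scalar subrr mul0mx.
Qed.

Lemma resolventE w : w \notin char_roots ->
  w%:M - X \in unitmx /\ invmx (w%:M - X) = newton_resolvent char_roots w.
Proof.
move=> wr; have := newton_resolventP wr.
rewrite scaler_prod prod_char_roots scaler0 subr0 => wN.
have [u _] := mulmx1_unit wN; split=> //.
by rewrite -[RHS](mulKmx u) mulmxE wN mulr1.
Qed.

Variable G : contour R.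

Lemma contour_continuous_newton s : (forall z, z \in s -> ~ contour_support G z) ->
  contour_continuous_mx G (newton_resolvent s).
Proof.
elim: s => [_|z s IH sS] /=; first exact: contour_continuous_mx_cst.
apply: contour_continuous_mxZ.
  by apply: contour_continuous_inv; apply: sS; rewrite mem_head.
apply: contour_continuous_mxD; first exact: contour_continuous_mx_cst.
apply: contour_continuous_mulmx; first exact: contour_continuous_mx_cst.
by apply: IH => y ys; apply: sS; rewrite in_cons ys orbT.
Qed.

(** [r] accumulates the poles already taken out of the Newton form. Unfolding one step moves the
    head [z] of [s] into [r]; since [r] was nonempty, the new scalar term has at least two poles and
    integrates to zero, and the rest is the same integral for [rcons r z] and [s]. *)
Lemma contour_integral_newton_inv_prod r s : r != [::] ->
  (forall z, z \in r ++ s -> encircled G z) ->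
  mx_contour_integral G (fun w => inv_prod r w *: newton_resolvent s w) = 0.
Proof.
elim: s r => [|z s IH] r r0 rsE.
  apply/matrixP => i j; rewrite !mxE -(contour_integral0 G).
  by apply: eq_contour_integral => w _; rewrite !mxE mulr0.
have rE y : y \in rcons r z -> encircled G y.
  by rewrite mem_rcons in_cons => yr; apply: rsE; rewrite mem_cat in_cons orbA orbC orbA;
    case/orP: yr => ->; rewrite ?orbT.
have sE y : y \in s -> encircled G y.
  by move=> ys; apply: rsE; rewrite mem_cat in_cons ys !orbT.
have c1 : contour_continuous G (inv_prod (rcons r z)).
  by apply: contour_continuous_inv_prod => y /rE[].
have c2 : contour_continuous_mx G (newton_resolvent s).
  by apply: contour_continuous_newton => y /sE[].
rewrite (_ : (fun w => _) = fun w => inv_prod (rcons r z) w *: 1 +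
    (X - z%:M) *m (inv_prod (rcons r z) w *: newton_resolvent s w)); last first.
  apply/funext => w /=; rewrite -scalemxAr -scalerDr scalerA /inv_prod.
  by rewrite -cats1 big_cat big_seq1.
rewrite mx_contour_integralD; last 2 first.
- by apply: contour_continuous_mxZ => //; exact: contour_continuous_mx_cst.
- apply: contour_continuous_mulmx; first exact: contour_continuous_mx_cst.
  exact: contour_continuous_mxZ.
rewrite mx_contour_integral_mull; last exact: contour_continuous_mxZ.
rewrite IH ?mulmx0 ?addr0; last 2 first.
- by case: (r).
- by move=> y; rewrite cat_rcons; exact: rsE.
rewrite mx_contour_integralZ//.
case: r r0 {IH rsE c1} rE => // y r _ rE.
by rewrite (@contour_integral_inv_prod _ _ (size r).+1) ?scale0r//= size_rcons.
Qed.

Hypothesis XE : forall z, z%:M - X \notin unitmx -> encircled G z.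

Lemma contour_notin_char_roots w : contour_support G w -> w \notin char_roots.
Proof. by move=> wS; apply/negP => /char_roots_not_unit/XE[]. Qed.

Lemma contour_continuous_resolvent :
  contour_continuous_mx G (fun w => invmx (w%:M - X)).
Proof.
apply: (@eq_continuous_contour_mx _ _ _ _ (newton_resolvent char_roots)).
  by move=> w /set_mem/contour_notin_char_roots/resolventE[_ ->].
by apply: contour_continuous_newton => z /char_roots_not_unit/XE[].
Qed.

Lemma contour_integral_resolvent :
  mx_contour_integral G (fun w => invmx (w%:M - X)) = (two_pi_i R)%:M.
Proof.
rewrite (@eq_mx_contour_integral _ _ _ _ _ (newton_resolvent char_roots)); last first.
  by move=> w /set_mem/contour_notin_char_roots/resolventE[_ ->].
have rE z : z \in char_roots -> encircled G z by move=> /char_roots_not_unit/XE.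
(* The list of roots is nonempty: an empty product would be 1, not 0. Its first root gives the only
   term with a single pole, hence the value 2 pi i. *)
have := prod_char_roots; case: char_roots rE => [|z s] rE.
  by rewrite big_nil => /eqP; rewrite oner_eq0.
move=> _; have zE := rE z (mem_head _ _).
have sE y : y \in s -> encircled G y by move=> ys; apply: rE; rewrite in_cons ys orbT.
have c1 : contour_continuous G (inv_prod [:: z]).
  by apply: contour_continuous_inv_prod => y; rewrite inE => /eqP ->; case: zE.
have c2 : contour_continuous_mx G (newton_resolvent s).
  by apply: contour_continuous_newton => y /sE[].
rewrite (_ : newton_resolvent _ = fun w => inv_prod [:: z] w *: 1 +
    (X - z%:M) *m (inv_prod [:: z] w *: newton_resolvent s w)); last first.
  by apply/funext => w /=; rewrite -scalemxAr -scalerDr /inv_prod big_seq1.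
rewrite mx_contour_integralD; last 2 first.
- by apply: contour_continuous_mxZ => //; exact: contour_continuous_mx_cst.
- apply: contour_continuous_mulmx; first exact: contour_continuous_mx_cst.
  exact: contour_continuous_mxZ.
rewrite mx_contour_integral_mull; last exact: contour_continuous_mxZ.
rewrite contour_integral_newton_inv_prod// mulmx0 addr0 mx_contour_integralZ//.
rewrite (@contour_integral_inv_prod _ _ 0)//; first by rewrite scalemx1.
by move=> y; rewrite inE => /eqP ->.
Qed.

End Resolvent.

(** * Differentiation under the integral sign *)

Section DerivativeUnderIntegral.
Variable R : realType.
Implicit Types (a b t : R) (z w : R[i]).
Local Notation Re := (@complex.Re R).
Local Notation Im := (@complex.Im R).

Lemma is_derive_under_Rintegral a b t (f df : R -> R -> R) (K : R) :
  (forall x, bounded_measurable a b (f x)) ->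
  (forall x s, is_derive x (1 : R) (f ^~ s) (df x s)) ->
  (forall x s, x \in `]t - 1, t + 1[ -> s \in `[a, b] -> `|df x s| <= K) ->
  is_derive t (1 : R) (fun x => \int[lebesgue_measure]_(s in `[a, b]) f x s)
    (\int[lebesgue_measure]_(s in `[a, b]) df t s).
Proof.
move=> bf dfd dfK.
have tI : `]t - 1, t + 1[%classic t by rewrite /= in_itv/=; apply/andP; split; lra.
have intf x : `]t - 1, t + 1[%classic x ->
    lebesgue_measure.-integrable `[a, b] (EFin \o f x).
  by move=> _; exact: bounded_measurable_integrable.
have der x s : `]t - 1, t + 1[%classic x -> `[a, b]%classic s ->
    derivable (f ^~ s) x 1.
  by move=> _ _; have d := dfd x s; exact: ex_derive.
have p1 x s : partial1of2 f x s = df x s.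
  by have d := dfd x s; rewrite /partial1of2 derive1E; exact: derive_val.
(* The dominating constant must be nonnegative, whereas [K] may be negative when [[a, b]] is
   empty. *)
have K0 (s : R) : 0 <= `|K| by [].
have intK : lebesgue_measure.-integrable `[a, b] (EFin \o (fun _ : R => `|K|)).
  apply: bounded_measurable_integrable.
  by apply: continuous_bounded_measurable => s; exact: cvg_cst.
have ub x s : `]t - 1, t + 1[%classic x -> `[a, b]%classic s ->
    `|partial1of2 f x s| <= `|K|.
  by move=> xt sab; rewrite p1 (le_trans (dfK _ _ xt sab))// ler_norm.
apply: DeriveDef.
  by apply: (derivable_under_integral _ tI intf der K0 intK ub); exact: measurable_itv.
rewrite -derive1E (differentiation_under_integral _ tI intf der K0 intK ub);
  last exact: measurable_itv.
by apply: eq_Rintegral => s _; rewrite p1.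
Qed.

(** The l1 norm takes values in [R], while the norm of [R[i]] takes them in [R[i]]. It is
    submultiplicative and dominates both parts, so one estimate serves the two real integrals or
    series. *)
Definition norm1C z : R := `|Re z| + `|Im z|.

Lemma ler_Re_norm1C z : `|Re z| <= norm1C z.
Proof. by rewrite lerDl. Qed.

Lemma ler_Im_norm1C z : `|Im z| <= norm1C z.
Proof. by rewrite lerDr. Qed.

Lemma norm1C_ge0 z : 0 <= norm1C z.
Proof. exact: addr_ge0. Qed.

Lemma norm1CD z w : norm1C (z + w) <= norm1C z + norm1C w.
Proof.
rewrite /norm1C ReD ImD.
have := ler_normD (Re z) (Re w); have := ler_normD (Im z) (Im w); lra.
Qed.

Lemma norm1CM z w : norm1C (z * w) <= norm1C z * norm1C w.
Proof.
rewrite /norm1C ReM ImM.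
have := ler_normB (Re z * Re w) (Im z * Im w).
have := ler_normD (Re z * Im w) (Im z * Re w).
rewrite !normrM; lra.
Qed.

Lemma norm1C_sum n (F : 'I_n -> R[i]) :
  norm1C (\sum_k F k) <= \sum_k norm1C (F k).
Proof.
apply: (big_ind2 (fun x y => norm1C x <= y)) => //.
  by rewrite /norm1C normr0 addr0.
by move=> x1 x2 y1 y2 h1 h2; apply: le_trans (norm1CD _ _) _; exact: lerD.
Qed.

Lemma norm1C_exp z : norm1C (expC z) <= 2 * expR `|Re z|.
Proof.
rewrite /norm1C /expC/= !normrM (ger0_norm (expR_ge0 _)) -mulrDr mulrC.
apply: ler_pM => //; rewrite ?addr_ge0//; last by rewrite ler_expR ler_norm.
have c1 : `|cos (Im z)| <= 1 by rewrite ler_norml cos_geN1 cos_le1.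
have s1 : `|sin (Im z)| <= 1 by rewrite ler_norml sin_geN1 sin_le1.
lra.
Qed.

Lemma bounded_measurableC_norm1C a b (f : R -> R[i]) : bounded_measurableC a b f ->
  exists M : R, forall s, s \in `[a, b] -> norm1C (f s) <= M.
Proof.
move=> [[_ [M fM]] [_ [N fN]]]; exists (M + N) => s sab.
by apply: lerD; [exact: fM|exact: fN].
Qed.

Lemma is_deriveC_expM z t : is_deriveC (fun x => expC (z * x%:C%C)) t
  (z * expC (z * t%:C%C)).
Proof.
have := is_deriveC_exp (is_deriveCZ z (is_deriveC_real t)).
by rewrite mulr1 mulrC.
Qed.

Lemma is_deriveC_integral_exp a b t (g q : R -> R[i]) :
  continuousC_on a b g -> bounded_measurableC a b q ->
  is_deriveC (fun x => integralC a b (fun s => expC (g s * x%:C%C) * q s)) t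
    (integralC a b (fun s => g s * expC (g s * t%:C%C) * q s)).
Proof.
move=> cg bq.
have [M gM] := bounded_measurableC_norm1C (continuousC_bounded_measurable cg).
have [N qN] := bounded_measurableC_norm1C bq.
(* A bound for the derived integrand over the window: [M] and [N] bound [g] and [q], |x| < |t| + 1,
   and the 2 comes from |cos| + |sin| <= 2. *)
pose K := M * (2 * expR (M * (`|t| + 1))) * N.
have bf x : bounded_measurableC a b (fun s => expC (g s * x%:C%C) * q s).
  apply: bounded_measurableCM => //; apply: continuousC_bounded_measurable.
  apply: continuousC_on_exp; apply: continuousC_onM => //.
  exact: continuousC_on_cst.
have fd x s : is_deriveC (fun x => expC (g s * x%:C%C) * q s) x
    (g s * expC (g s * x%:C%C) * q s).
  have := is_deriveCM (is_deriveC_expM (g s) x) (is_deriveC_cst (q s) x).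
  by rewrite mulr0 addr0.
have fK x s : x \in `]t - 1, t + 1[ -> s \in `[a, b] ->
    norm1C (g s * expC (g s * x%:C%C) * q s) <= K.
  rewrite in_itv/= => /andP[tx xt] sab.
  have M0 := le_trans (norm1C_ge0 _) (gM s sab).
  have N0 := le_trans (norm1C_ge0 _) (qN s sab).
  apply: le_trans (norm1CM _ _) _; apply: ler_pM; rewrite ?norm1C_ge0 ?qN//.
  apply: le_trans (norm1CM _ _) _; apply: ler_pM; rewrite ?norm1C_ge0 ?gM//.
  apply: le_trans (norm1C_exp _) _; rewrite ler_pM2l// ler_expR.
  rewrite ReM /= mulr0 subr0 normrM; apply: ler_pM => //.
    exact: le_trans (ler_Re_norm1C _) (gM s sab).
  have := ler_norm t; have := ler_norm (- t); rewrite normrN ler_norml => ? ?.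
  by apply/andP; split; lra.
split.
  apply: (@is_derive_under_Rintegral _ _ _
    (fun x s => Re (expC (g s * x%:C%C) * q s))
    (fun x s => Re (g s * expC (g s * x%:C%C) * q s)) K).
  - by move=> x; case: (bf x).
  - by move=> x s; case: (fd x s).
  - by move=> x s xt sab; exact: le_trans (ler_Re_norm1C _) (fK x s xt sab).
apply: (@is_derive_under_Rintegral _ _ _
  (fun x s => Im (expC (g s * x%:C%C) * q s))
  (fun x s => Im (g s * expC (g s * x%:C%C) * q s)) K).
- by move=> x; case: (bf x).
- by move=> x s; case: (fd x s).
- by move=> x s xt sab; exact: le_trans (ler_Im_norm1C _) (fK x s xt sab).
Qed.

(** The weight [q] of the preceding lemma is here an entry of [F] along the path times [derive1C G],
    bounded and measurable but possibly discontinuous at breakpoints. *)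
Lemma is_derive_mx_contour_integral_exp (G : contour R) m n
    (F : R[i] -> 'M[R[i]]_(m, n)) t : contour_continuous_mx G F ->
  is_derive_mx
    (fun x => mx_contour_integral G (fun w => expC (w * x%:C%C) *: F w)) t
    (mx_contour_integral G (fun w => (w * expC (w * t%:C%C)) *: F w)).
Proof.
move=> cF i j; have bq := contour_continuous_bounded (cF i j).
have := is_deriveC_integral_exp t (continuousC_contour G) bq.
rewrite !mxE /contour_integral.
rewrite (_ : (fun x => mx_contour_integral _ _ _ _) = fun x =>
  integralC (contour_start G) (contour_end G)
    (fun s => expC (G s * x%:C%C) * (F (G s) i j * derive1C G s))).
  by under [in X in is_deriveC _ _ X -> _]eq_fun do rewrite mulrA;
     under [in X in _ -> is_deriveC _ _ X]eq_fun do rewrite mxE.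
apply/funext => x; rewrite mxE /contour_integral; congr (integralC _ _ _).
by apply/funext => s; rewrite mxE mulrA.
Qed.

End DerivativeUnderIntegral.

(** * The matrix exponential *)

Section MatrixExponential.
Variables (R : realType) (n : nat) (X : 'M[R[i]]_n.+1).
Implicit Types (t x : R) (A : 'M[R[i]]_n.+1).
Local Notation Re := (@complex.Re R).
Local Notation Im := (@complex.Im R).

(** Componentwise convergence gives access to real power series; [cvgC_norm] converts it to the norm
    topology in which [expmx] takes its limit. *)
Definition cvgC (u : nat -> R[i]) (l : R[i]) :=
  (fun k => Re (u k)) @ \oo --> Re l /\ (fun k => Im (u k)) @ \oo --> Im l.

Lemma cvgC_unique u l1 l2 : cvgC u l1 -> cvgC u l2 -> l1 = l2.
Proof.
move=> [r1 i1] [r2 i2]; apply: complex_eq.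
  exact: (cvg_unique _ r1 r2).
exact: (cvg_unique _ i1 i2).
Qed.

Lemma cvgC_cst z : cvgC (fun=> z) z.
Proof. by split; exact: cvg_cst. Qed.

Lemma cvgCD u v l1 l2 : cvgC u l1 -> cvgC v l2 ->
  cvgC (fun k => u k + v k) (l1 + l2).
Proof.
move=> [r1 i1] [r2 i2]; split.
  rewrite ReD (_ : (fun k => _) = fun k => Re (u k) + Re (v k)); first exact: cvgD.
  by apply/funext => k; rewrite ReD.
rewrite ImD (_ : (fun k => _) = fun k => Im (u k) + Im (v k)); first exact: cvgD.
by apply/funext => k; rewrite ImD.
Qed.

Lemma cvgCZ u l z : cvgC u l -> cvgC (fun k => z * u k) (z * l).
Proof.
move=> [r i]; split.
  rewrite ReM (_ : (fun k => _) = fun k => Re z * Re (u k) - Im z * Im (u k)).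
    by apply: cvgB; exact: cvgMr.
  by apply/funext => k; rewrite ReM.
rewrite ImM (_ : (fun k => _) = fun k => Re z * Im (u k) + Im z * Re (u k)).
  by apply: cvgD; exact: cvgMr.
by apply/funext => k; rewrite ImM.
Qed.

Lemma cvgC_sum p (u : 'I_p -> nat -> R[i]) (l : 'I_p -> R[i]) :
  (forall i, cvgC (u i) (l i)) -> cvgC (fun k => \sum_i u i k) (\sum_i l i).
Proof.
elim: p u l => [|p IH] u l ul.
  rewrite big_ord0 (_ : (fun k => _) = fun=> 0); first exact: cvgC_cst.
  by apply/funext => k; rewrite big_ord0.
rewrite big_ord_recl (_ : (fun k => _) =
    fun k => u ord0 k + \sum_(i < p) u (lift ord0 i) k).
  by apply: cvgCD => //; exact: IH.
by apply/funext => k; rewrite big_ord_recl.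
Qed.

Lemma cvgC_norm (u : nat -> (R[i] : numFieldType)) (l : (R[i] : numFieldType)) :
  cvgC u l -> u @ \oo --> l.
Proof.
move=> [/cvgrPdist_lt ur /cvgrPdist_lt ui]; apply/cvgrPdist_lt => e.
(* A positive element of [R[i]] is a positive real, so half of [Re e] can serve as tolerance for
   each part. *)
rewrite ltcE/= => /andP[/eqP e0 er].
have e2 : 0 < Re e / 2 by rewrite divr_gt0.
near=> k.
have kr : `|Re l - Re (u k)| < Re e / 2 by near: k; exact: ur.
have ki : `|Im l - Im (u k)| < Re e / 2 by near: k; exact: ui.
rewrite normc_def ReD ImD ReN ImN ltcE /= e0 eqxx/=.
rewrite -(ltr_pXn2r (n := 2))// ?nnegrE ?sqrtr_ge0 ?(ltW er)// sqr_sqrtr ?addr_ge0 ?sqr_ge0//.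
rewrite -(real_normK (num_real (Re l - _))) -(real_normK (num_real (Im l - _))).
have := normr_ge0 (Re l - Re (u k)); have := normr_ge0 (Im l - Im (u k)).
nra.
Unshelve. all: by end_near. Qed.

Definition entry_norm A : R := \sum_i \sum_j norm1C (A i j).

Lemma norm1C_entry A i j : norm1C (A i j) <= entry_norm A.
Proof.
rewrite /entry_norm (bigD1 i)//= (bigD1 j)//= -addrA lerDl addr_ge0//.
  by apply: sumr_ge0 => k _; exact: norm1C_ge0.
by apply: sumr_ge0 => k _; apply: sumr_ge0 => l _; exact: norm1C_ge0.
Qed.

(** A column of [A2] is bounded by the sum of all its entries. The hypothesis and the conclusion are
    both uniform entry bounds, so the estimate iterates to powers of [X]. *)
Lemma norm1C_mul_entry A1 A2 (K : R) i j : (forall k l, norm1C (A1 k l) <= K) ->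
  norm1C ((A1 * A2) i j) <= K * entry_norm A2.
Proof.
move=> AK; have K0 : 0 <= K := le_trans (norm1C_ge0 _) (AK i j).
rewrite mxE; apply: le_trans (norm1C_sum _) _; rewrite /entry_norm mulr_sumr.
apply: ler_sum => k _; apply: le_trans (norm1CM _ _) _.
apply: ler_pM; rewrite ?norm1C_ge0//.
rewrite (bigD1 j)//= lerDl; apply: sumr_ge0 => l _; exact: norm1C_ge0.
Qed.

Lemma norm1C_expr_entry A k i j :
  norm1C ((A * X ^+ k) i j) <= entry_norm A * entry_norm X ^+ k.
Proof.
elim: k i j => [|k IH] i j; first by rewrite !expr0 !mulr1 norm1C_entry.
by rewrite !exprSr !mulrA; exact: norm1C_mul_entry.
Qed.

(** Taylor coefficients at 0 of the real part of an entry of A e^(tX). The extra factor [A] closes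
    the family under termwise differentiation, which replaces [A] by [A * X]. *)
Definition exp_coeff_Re A i j k : R := Re ((A * X ^+ k) i j) / k`!%:R.
Definition exp_coeff_Im A i j k : R := Im ((A * X ^+ k) i j) / k`!%:R.

Lemma pseries_diffs_Re A i j :
  pseries_diffs (exp_coeff_Re A i j) = exp_coeff_Re (A * X) i j.
Proof.
apply/funext => k; rewrite /pseries_diffs /exp_coeff_Re factS natrM exprS (mulrA A).
by rewrite mulrCA invfM mulVKf// pnatr_eq0.
Qed.

Lemma pseries_diffs_Im A i j :
  pseries_diffs (exp_coeff_Im A i j) = exp_coeff_Im (A * X) i j.
Proof.
apply/funext => k; rewrite /pseries_diffs /exp_coeff_Im factS natrM exprS (mulrA A).
by rewrite mulrCA invfM mulVKf// pnatr_eq0.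
Qed.

(** Comparison with the real exponential series of B |x|, scaled by [K]. *)
Lemma cvg_pseries_fact_bound (c : nat -> R) (K B : R) x : 0 <= K -> 0 <= B ->
  (forall k, `|c k| <= K * B ^+ k / k`!%:R) -> cvgn (pseries c x).
Proof.
move=> K0 B0 cK; apply: normed_cvg.
apply: (@series_le_cvg _ _ (K *: exp_coeff (B * `|x|))).
- by move=> k; exact: normr_ge0.
- move=> k; rewrite [leRHS](_ : _ = K * exp_coeff (B * `|x|) k)//.
  by rewrite mulr_ge0// exp_coeff_ge0// mulr_ge0.
- move=> k; rewrite [leRHS](_ : _ = K * ((B * `|x|) ^+ k / k`!%:R))//.
  rewrite [leLHS](_ : _ = `|c k * x ^+ k|)// normrM normrX exprMn.
  rewrite mulrA mulrA mulrAC; apply: ler_wpM2r; first exact: exprn_ge0.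
  exact: cK.
- exact/is_cvg_seriesZ/is_cvg_series_exp_coeff.
Qed.

Lemma entry_norm_ge0 A : 0 <= entry_norm A.
Proof. by apply: sumr_ge0 => i _; apply: sumr_ge0 => j _; exact: norm1C_ge0. Qed.

Lemma is_cvg_exp_coeff_Re A i j x : cvgn (pseries (exp_coeff_Re A i j) x).
Proof.
apply: (@cvg_pseries_fact_bound _ (entry_norm A) (entry_norm X));
  [exact: entry_norm_ge0..|].
move=> k; rewrite normrM normfV (ger0_norm (ler0n _ _)).
rewrite ler_wpM2r ?invr_ge0 ?ler0n//.
exact: le_trans (ler_Re_norm1C _) (norm1C_expr_entry _ _ _ _).
Qed.

Lemma is_cvg_exp_coeff_Im A i j x : cvgn (pseries (exp_coeff_Im A i j) x).
Proof.
apply: (@cvg_pseries_fact_bound _ (entry_norm A) (entry_norm X));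
  [exact: entry_norm_ge0..|].
move=> k; rewrite normrM normfV (ger0_norm (ler0n _ _)).
rewrite ler_wpM2r ?invr_ge0 ?ler0n//.
exact: le_trans (ler_Im_norm1C _) (norm1C_expr_entry _ _ _ _).
Qed.

Definition expmx_series A t : 'M[R[i]]_n.+1 := \matrix_(i, j)
  (limn (pseries (exp_coeff_Re A i j) t) +i* limn (pseries (exp_coeff_Im A i j) t))%C.

Lemma is_derive_expmx_series A t :
  is_derive_mx (expmx_series A) t (expmx_series (A * X) t).
Proof.
move=> i j; rewrite mxE; split.
  rewrite (_ : (fun s => _) = fun s => limn (pseries (exp_coeff_Re A i j) s)); last first.
    by apply/funext => s; rewrite mxE.
  (* Termwise differentiation needs the series and its first two derived series to converge at some
     point beyond |t|; these converge everywhere, so |t| + 1 serves. *)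
  rewrite /= -pseries_diffs_Re; apply: (@pseries_snd_diffs _ _ (`|t| + 1)).
  - exact: is_cvg_exp_coeff_Re.
  - by rewrite pseries_diffs_Re; exact: is_cvg_exp_coeff_Re.
  - by rewrite !pseries_diffs_Re; exact: is_cvg_exp_coeff_Re.
  - by rewrite [ltRHS]ger0_norm ?addr_ge0// ltrDl.
rewrite (_ : (fun s => _) = fun s => limn (pseries (exp_coeff_Im A i j) s)); last first.
  by apply/funext => s; rewrite mxE.
rewrite /= -pseries_diffs_Im; apply: (@pseries_snd_diffs _ _ (`|t| + 1)).
- exact: is_cvg_exp_coeff_Im.
- by rewrite pseries_diffs_Im; exact: is_cvg_exp_coeff_Im.
- by rewrite !pseries_diffs_Im; exact: is_cvg_exp_coeff_Im.
- by rewrite [ltRHS]ger0_norm ?addr_ge0// ltrDl.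
Qed.

Definition expmx_partial t N : 'M[R[i]]_n.+1 :=
  series (fun k : nat => (k`!%:R : R[i])^-1 *: (t%:C%C *: X) ^+ k) N.

Lemma cvg_expmx_partial A t i j :
  cvgC (fun N => (A * expmx_partial t N) i j) (expmx_series A t i j).
Proof.
pose u k := exp_coeff_Re A i j k * t ^+ k.
pose v k := exp_coeff_Im A i j k * t ^+ k.
(* As [t] is real, its powers scale real and imaginary parts separately, and the matrix partial sum
   splits into two real ones. *)
have E N : (A * expmx_partial t N) i j = (series u N +i* series v N)%C.
  elim: N => [|N IH].
    by rewrite /expmx_partial /series/= !big_geq// mulr0 mxE.
  rewrite /expmx_partial !seriesSr mulrDr mxE.
  rewrite -[series _ N]/(expmx_partial t N) IH -scalerAr exprZn -scalerAr.
  rewrite scalerA mxE.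
  rewrite (_ : (N`!%:R)^-1 * t%:C%C ^+ N = (t ^+ N / N`!%:R)%:C%C); last first.
    by rewrite mulrC rmorphM fmorphV rmorph_nat rmorphXn.
  apply: complex_eq; rewrite !(ReD, ImD, ReM, ImM) /= /u /v /exp_coeff_Re /exp_coeff_Im.
    by rewrite mul0r subr0; congr (_ + _); ring.
  by rewrite mul0r addr0; congr (_ + _); ring.
rewrite /expmx_series mxE; split => /=.
  rewrite (_ : (fun N => _) = pseries (exp_coeff_Re A i j) t).
    exact: is_cvg_exp_coeff_Re.
  by apply/funext => N; rewrite E.
rewrite (_ : (fun N => _) = pseries (exp_coeff_Im A i j) t).
  exact: is_cvg_exp_coeff_Im.
by apply/funext => N; rewrite E.
Qed.

Lemma expmx_seriesE t : expmx (t%:C%C *: X) = expmx_series 1 t.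
Proof.
apply: cvg_lim; first exact: norm_hausdorff.
(* A neighbourhood of a matrix contains a box [Q] of neighbourhoods of its entries; there being
   finitely many entries, eventual membership holds for all of them at once. *)
move=> P [Q Q1 QP].
have Qij : \forall N \near \oo, forall ij : 'I_n.+1 * 'I_n.+1,
    Q ij.1 ij.2 (expmx_partial t N ij.1 ij.2).
  apply: filter_forall => -[i j] /=.
  have := cvg_expmx_partial 1 t i j.
  under [in X in cvgC X _]eq_fun do rewrite mul1r.
  move=> /cvgC_norm; apply; exact: Q1.
by apply: filterS Qij => N QN; apply: QP => i j; exact: (QN (i, j)).
Qed.

(** Both sides are limits of the same partial sums. It turns the derivative, obtained as the series
    for the factor [X], into X e^(tX). *)
Lemma expmx_series_mull A t : expmx_series A t = A * expmx_series 1 t.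
Proof.
apply/matrixP => i j; apply: cvgC_unique (cvg_expmx_partial A t i j) _.
rewrite mxE (_ : (fun N => _) = fun N => \sum_k A i k * expmx_partial t N k j).
  apply: cvgC_sum => k; apply: cvgCZ.
  have := cvg_expmx_partial 1 t k j.
  by under [in X in cvgC X _]eq_fun do rewrite mul1r.
by apply/funext => N; rewrite mxE.
Qed.

Lemma is_derive_expmx t : is_derive_mx (fun x => expmx (x%:C%C *: X)) t
  (X * expmx (t%:C%C *: X)).
Proof.
rewrite (_ : (fun x => _) = expmx_series 1).
  have := is_derive_expmx_series 1 t.
  by rewrite mul1r expmx_seriesE expmx_series_mull.
by apply/funext => x; rewrite expmx_seriesE.
Qed.

Lemma expmx0 : expmx (0%:C%C *: X) = 1.
Proof.
rewrite expmx_seriesE; apply/matrixP => i j.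
apply: cvgC_unique (cvg_expmx_partial 1 0 i j) _.
(* The partial sum for N = 0 is empty, so the sequence is constant only from N = 1 on. *)
have S N : (0 < N)%N -> expmx_partial 0 N = 1.
  case: N => // N _; rewrite /expmx_partial /series/= big_nat_recl//=.
  rewrite big1 ?addr0 ?fact0 ?invr1 ?expr0 ?scale1r// => k _.
  by rewrite scale0r exprS mul0r scaler0.
have E : \forall N \near \oo, (1 * expmx_partial 0 N) i j = (1 : 'M[R[i]]_n.+1) i j.
  by near=> N; rewrite mul1r S//; near: N; exact: nbhs_infty_gt.
by split; apply: cvg_near_cst; apply: filterS E => N ->.
Unshelve. all: by end_near. Qed.

End MatrixExponential.

(** * Cauchy formula for the matrix exponential *)

Section MatrixDerivatives.
Variables (R : realType) (n : nat).
Implicit Types (t s : R) (F H : R -> 'M[R[i]]_n).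

Lemma is_derive_mxM F H t dF dH : is_derive_mx F t dF -> is_derive_mx H t dH ->
  is_derive_mx (fun x => F x *m H x) t (dF *m H t + F t *m dH).
Proof.
move=> Fd Hd i j; rewrite !mxE -big_split/=.
rewrite (_ : (fun x => _) = fun x => \sum_k F x i k * H x k j).
  by apply: is_deriveC_sum => k; apply: is_deriveCM; [exact: Fd|exact: Hd].
by apply/funext => x; rewrite mxE.
Qed.

Lemma is_derive_mxZ F t dF z : is_derive_mx F t dF ->
  is_derive_mx (fun x => z *: F x) t (z *: dF).
Proof.
move=> Fd i j; rewrite mxE (_ : (fun x => _) = fun x => z * F x i j).
  exact: is_deriveCZ (Fd i j).
by apply/funext => x; rewrite mxE.
Qed.

Lemma is_derive_mx_comp_opp F t dF : is_derive_mx F (- t) dF ->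
  is_derive_mx (fun x => F (- x)) t (- dF).
Proof.
move=> Fd i j; have [fr fi] := Fd i j; rewrite mxE.
have dN : is_derive t (1 : R) (-%R : R -> R) (-1) by exact: is_deriveNid.
split.
  rewrite -[complex.Re _]/(complex.Re _) ReN -mulrN1.
  exact: (is_derive1_comp fr dN).
rewrite ImN -mulrN1.
exact: (is_derive1_comp fi dN).
Qed.

Lemma is_derive_mx0_cst F : (forall t, is_derive_mx F t 0) ->
  forall t s, F t = F s.
Proof.
move=> F0 t s; apply/matrixP => i j.
have d x : is_deriveC (fun y => F y i j) x 0 by have := F0 x i j; rewrite mxE.
apply: complex_eq.
  by apply: (@is_derive_0_is_cst _ (fun y => complex.Re (F y i j))) => x; case: (d x).
by apply: (@is_derive_0_is_cst _ (fun y => complex.Im (F y i j))) => x; case: (d x).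
Qed.

(** Both equations for [F] are used: differentiating F(-x) K(x) gives - F(-x) X K(x) + F(-x) X K(x),
    where the right-hand equation for [F] puts [X] between the factors. With K = F the constancy
    makes F(-t) invertible, and K = H then yields the same inverse. *)
Lemma is_derive_mx_exp_unique X F H : F 0 = 1%:M -> H 0 = 1%:M ->
  (forall t, is_derive_mx F t (X *m F t)) ->
  (forall t, is_derive_mx F t (F t *m X)) ->
  (forall t, is_derive_mx H t (X *m H t)) -> forall t, F t = H t.
Proof.
move=> F0 H0 Fl Fr Hl t.
(* [F (- x) *m K x] is constant as soon as [K' = X K]. *)
have FK K : K 0 = 1%:M -> (forall x, is_derive_mx K x (X *m K x)) ->
    F (- t) *m K t = 1%:M.
  move=> K0 Kl; transitivity (F (- 0) *m K 0); last by rewrite oppr0 F0 K0 mulmx1.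
  apply: (@is_derive_mx0_cst (fun x => F (- x) *m K x)) => x.
  have := is_derive_mxM (is_derive_mx_comp_opp (Fr (- x))) (Kl x).
  by rewrite mulNmx mulmxA addNr.
have FF := FK F F0 Fl; have FH := FK H H0 Hl.
have [u _] := mulmx1_unit FF.
by rewrite -[LHS](mulKmx u) FF -FH mulKmx.
Qed.

End MatrixDerivatives.

Section ExponentialCauchyFormula.
Variables (R : realType) (n : nat) (G : contour R) (X : 'M[R[i]]_n.+1).
Hypothesis XE : forall z, z%:M - X \notin unitmx -> encircled G z.

Definition exp_resolvent_integral t : 'M[R[i]]_n.+1 :=
  (two_pi_i R)^-1 *: mx_contour_integral G
    (fun w => expC (w * t%:C%C) *: invmx (w%:M - X)).

Definition exp_resolvent_integral' t : 'M[R[i]]_n.+1 :=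
  (two_pi_i R)^-1 *: mx_contour_integral G
    (fun w => (w * expC (w * t%:C%C)) *: invmx (w%:M - X)).

Local Notation V := exp_resolvent_integral.
Local Notation V' := exp_resolvent_integral'.

Lemma resolvent_unit w : contour_support G w -> w%:M - X \in unitmx.
Proof. by move=> /(contour_notin_char_roots XE)/resolventE[]. Qed.

Let cR := contour_continuous_resolvent XE.
Let ce t := @contour_continuous_exp R G t.
Let c1 t : contour_continuous_mx G (fun w => expC (w * t%:C%C) *: (1 : 'M[R[i]]_n.+1)).
Proof. by apply: contour_continuous_mxZ => //; exact: contour_continuous_mx_cst. Qed.
Let ceR t : contour_continuous_mx G (fun w => expC (w * t%:C%C) *: invmx (w%:M - X)).
Proof. exact: contour_continuous_mxZ. Qed.

Lemma exp_resolvent_integral_mull t : V' t = X *m V t.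
Proof.
rewrite /V /V' -scalemxAr; congr (_ *: _).
rewrite -mx_contour_integral_mull// -[RHS]add0r.
(* The zero just added becomes the integral of e^(wt) times the identity, so that the integrands can
   be compared pointwise. *)
rewrite -(scale0r (1 : 'M[R[i]]_n.+1)) -(contour_integral_exp G t).
rewrite -mx_contour_integralZ// -mx_contour_integralD//; last first.
  by apply: contour_continuous_mulmx => //; exact: contour_continuous_mx_cst.
apply: eq_mx_contour_integral => w /set_mem/resolvent_unit u.
rewrite -scalemxAr -scalerDr mulrC -scalerA; congr (_ *: _).
by have /eqP := mulmxV u; rewrite mulmxBl mul_scalar_mx subr_eq => /eqP.
Qed.

Lemma exp_resolvent_integral_mulr t : V' t = V t *m X.
Proof.
rewrite /V /V' -scalemxAl; congr (_ *: _).
rewrite -mx_contour_integral_mulr// -[RHS]add0r.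
rewrite -(scale0r (1 : 'M[R[i]]_n.+1)) -(contour_integral_exp G t).
rewrite -mx_contour_integralZ// -mx_contour_integralD//; last first.
  by apply: contour_continuous_mulmx => //; exact: contour_continuous_mx_cst.
apply: eq_mx_contour_integral => w /set_mem/resolvent_unit u.
rewrite -scalemxAl -scalerDr mulrC -scalerA; congr (_ *: _).
by have /eqP := mulVmx u; rewrite mulmxBr mul_mx_scalar subr_eq => /eqP.
Qed.

Lemma is_derive_exp_resolvent_integral t : is_derive_mx V t (V' t).
Proof. by apply: is_derive_mxZ; exact: is_derive_mx_contour_integral_exp. Qed.

Lemma exp_resolvent_integral0 : V 0 = 1.
Proof.
rewrite /V.
rewrite (@eq_mx_contour_integral _ _ _ _ _ (fun w => invmx (w%:M - X))).
  rewrite contour_integral_resolvent// scale_scalar_mx mulVf ?two_pi_i_neq0//.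
by move=> w _; rewrite mulr0 expC0 scale1r.
Qed.

Lemma exp_resolvent_integralE t : V t = expmx (t%:C%C *: X).
Proof.
apply: (@is_derive_mx_exp_unique _ _ X V (fun x => expmx (x%:C%C *: X))).
- exact: exp_resolvent_integral0.
- exact: expmx0.
- move=> x; rewrite -exp_resolvent_integral_mull.
  exact: is_derive_exp_resolvent_integral.
- move=> x; rewrite -exp_resolvent_integral_mulr.
  exact: is_derive_exp_resolvent_integral.
- exact: is_derive_expmx.
Qed.

End ExponentialCauchyFormula.

(** * Factorization of the pencil through its solvents, and the final formulas *)

Section Pencil.
Variables (R : realType) (n : nat) (B C : 'M[R[i]]_n.+1).
Implicit Types (X Z : 'M[R[i]]_n.+1) (w : R[i]).

(** Dividing the pencil by w - X on the right leaves the remainder X^2 + B X + C, which is zero for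
    a right solvent. *)
Lemma pencil_factor X w : right_solvent B C X ->
  pencil B C w = (w%:M + X + B) *m (w%:M - X).
Proof.
rewrite /right_solvent => /eqP; rewrite addrC addr_eq0 => /eqP CE.
rewrite /pencil CE mulmxBr mul_mx_scalar !mulmxDl mul_scalar_mx !scalerDr.
rewrite -[X *m X]/(X * X) -[w *: X + _ + _]addrA scale_scalar_mx -!expr2.
move: (w ^+ 2)%:M (X ^+ 2 + B *m X) => P S.
by rewrite opprD addrA [P + w *: X + _]addrAC addrK.
Qed.

Lemma solvent_encircled X (G : contour R) z : right_solvent B C X ->
  surrounds G (pencil_spectrum B C) -> z%:M - X \notin unitmx -> encircled G z.
Proof.
move=> hX [disj wind] zX.
have zS : pencil_spectrum B C z.
  by rewrite /pencil_spectrum /= (pencil_factor _ hX) unitmx_mul negb_and zX orbT.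
split; last exact: wind.
by move=> zG; have : (contour_support G `&` pencil_spectrum B C) z by []; rewrite disj.
Qed.

(** Multiplying the difference of the resolvents by L(w), factored through [X] in one term and
    through [Z] in the other, leaves (w + X + B) - (w + Z + B) = X - Z. *)
Lemma invmx_pencil X Z w : right_solvent B C X -> right_solvent B C Z ->
  complete_pair X Z -> w%:M - X \in unitmx -> w%:M - Z \in unitmx ->
  invmx (pencil B C w) =
  (invmx (w%:M - X) - invmx (w%:M - Z)) *m invmx (X - Z).
Proof.
move=> hX hZ hXZ uX uZ.
have LXZ : pencil B C w *m
    ((invmx (w%:M - X) - invmx (w%:M - Z)) *m invmx (X - Z)) = 1%:M.
  rewrite mulmxA mulmxBr {1}(pencil_factor _ hX) (pencil_factor _ hZ).
  rewrite !mulmxK// opprD addrACA subrr addr0 opprD addrACA subrr add0r.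
  exact: mulmxV.
have [u _] := mulmx1_unit LXZ.
by rewrite -[RHS](mulKmx u) LXZ mulmx1.
Qed.

(** The weight [h] is left free to serve both e^(wt) and w e^(wt). The continuity clause is what
    differentiation of [U] under the integral requires. *)
Lemma mx_contour_integral_pencil X Z (G : contour R) h :
  right_solvent B C X -> right_solvent B C Z -> complete_pair X Z ->
  surrounds G (pencil_spectrum B C) -> contour_continuous G h ->
  contour_continuous_mx G (fun w => invmx (pencil B C w)) /\
  mx_contour_integral G (fun w => h w *: invmx (pencil B C w)) =
  (mx_contour_integral G (fun w => h w *: invmx (w%:M - X)) -
   mx_contour_integral G (fun w => h w *: invmx (w%:M - Z))) *m invmx (X - Z).
Proof.
move=> hX hZ hXZ hG ch.
have XE z := @solvent_encircled X G z hX hG.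
have ZE z := @solvent_encircled Z G z hZ hG.
have cX := contour_continuous_resolvent XE.
have cZ := contour_continuous_resolvent ZE.
have cNZ : contour_continuous_mx G (fun w => (-1)%:M *m invmx (w%:M - Z)).
  by apply: contour_continuous_mulmx => //; exact: contour_continuous_mx_cst.
have cD := contour_continuous_mxD cX cNZ.
have LE w : contour_support G w -> invmx (pencil B C w) =
    (invmx (w%:M - X) + (-1)%:M *m invmx (w%:M - Z)) *m invmx (X - Z).
  move=> wG; rewrite mul_scalar_mx scaleN1r.
  by apply: invmx_pencil => //; exact: resolvent_unit wG.
split.
  apply: (@eq_continuous_contour_mx _ _ _ _ (fun w =>
    (invmx (w%:M - X) + (-1)%:M *m invmx (w%:M - Z)) *m invmx (X - Z))).
    by move=> w /set_mem/LE ->.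
  by apply: contour_continuous_mulmx => //; exact: contour_continuous_mx_cst.
have chX : contour_continuous_mx G (fun w => h w *: invmx (w%:M - X)).
  exact: contour_continuous_mxZ.
have chZ : contour_continuous_mx G (fun w => h w *: invmx (w%:M - Z)).
  exact: contour_continuous_mxZ.
have chNZ : contour_continuous_mx G (fun w => (-1)%:M *m (h w *: invmx (w%:M - Z))).
  by apply: contour_continuous_mulmx => //; exact: contour_continuous_mx_cst.
rewrite -[- mx_contour_integral G _]scaleN1r -mul_scalar_mx -mx_contour_integral_mull//.
rewrite -mx_contour_integralD// -mx_contour_integral_mulr; last first.
  exact: contour_continuous_mxD.
apply: eq_mx_contour_integral => w /set_mem/LE ->.
by rewrite -scalemxAr -scalerDr scalemxAl.
Qed.

End Pencil.

Theorem corollary11 (R : realType) (n : nat) (B C X Z : 'M[R[i]]_n)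
    (hX : right_solvent B C X) (hZ : right_solvent B C Z)
    (hXZ : complete_pair X Z)
    (G : contour R) (hG : surrounds G (pencil_spectrum B C)) :
  let U (t : R) : 'M[R[i]]_n :=
    (two_pi_i R)^-1 *: mx_contour_integral G
      (fun l => expC (l * t%:C%C) *: invmx (pencil B C l)) in
  let U' (t : R) : 'M[R[i]]_n :=
    (two_pi_i R)^-1 *: mx_contour_integral G
      (fun l => (l * expC (l * t%:C%C)) *: invmx (pencil B C l)) in
  forall t : R,
    [/\ U t = (expmx (t%:C%C *: X) - expmx (t%:C%C *: Z)) *m invmx (X - Z),
        is_derive_mx U t (U' t) &
        U' t = (X *m expmx (t%:C%C *: X) - Z *m expmx (t%:C%C *: Z))
               *m invmx (X - Z)].
Proof.
case: n B C X Z hX hZ hXZ hG => [|n] B C X Z hX hZ hXZ hG U U' t.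
  (* In dimension 0 there are no entries to compare; the other case has the ring structure of
     matrices of positive size. *)
  by split; [apply/matrixP => -[]|move=> []|apply/matrixP => -[]].
have XE z := @solvent_encircled _ _ _ _ X G z hX hG.
have ZE z := @solvent_encircled _ _ _ _ Z G z hZ hG.
have ce := @contour_continuous_exp _ G t.
have cle : contour_continuous G (fun w => w * expC (w * t%:C%C)).
  exact: contour_continuousM (contour_continuous_id G) ce.
have [cL UE] := mx_contour_integral_pencil hX hZ hXZ hG ce.
have [_ UE'] := mx_contour_integral_pencil hX hZ hXZ hG cle.
split.
- rewrite /U UE scalemxAl scalerBr.
  by rewrite -(exp_resolvent_integralE XE) -(exp_resolvent_integralE ZE).
- by apply: is_derive_mxZ; exact: is_derive_mx_contour_integral_exp.
- rewrite /U' UE' scalemxAl scalerBr.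
  (* The weight w e^(wt) produces the integrals [exp_resolvent_integral'] of [X] and [Z], which are
     X e^(tX) and Z e^(tZ). *)
  rewrite -(exp_resolvent_integralE XE) -(exp_resolvent_integralE ZE).
  by rewrite -(exp_resolvent_integral_mull XE) -(exp_resolvent_integral_mull ZE).
Qed.
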